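(* Let $m\ge 1$ be an integer and let $N\in\mathbb{Z}$ (allowing $N=0$). (i) The adjoint operator $T_m^{*}$ of $T_m$ on $\mathcal{H}$ leaves each space $\mathcal{H}_N$ invariant and acts on $F\in\mathcal{H}_N$ by $$T_m^{*}(F)(a,c,z)=\frac1m\sum_{k=0}^{m-1}e^{2\pi i kNa}F\Big(ma,\frac{c+k}{m},z\Big).$$ (ii) On each $\mathcal{H}_N$, $$T_m^{*}=R^{*}\circ T_m\circ R,$$ where $R^{*}=R^{3}$. (iii) Let $d=\gcd(m,N)$. For $F\in\mathcal{H}_N$, $$T_m^{*}\circ T_m(F)(a,c,z)=\frac1m\sum_{\ell=0}^{d-1}F\Big(a+\frac{\ell}{d},c,z\Big)$$ and $$T_m\circ T_m^{*}(F)(a,c,z)=\frac1m\sum_{\ell=0}^{d-1}e^{2\pi i\frac{N\ell}{d}a}F\Big(a,c+\frac{\ell}{d},z\Big).$$ The operators $T_m$ and $T_m^{*}$ commute on $\mathcal{H}_N$ when $d=1$, and then satisfy $T_m\circ T_m^{*}=T_m^{*}\circ T_m=\frac1m\mathbf{I}$. They do not commute on $\mathcal{H}_N$ when $d>1$.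
   Context: $H(\mathbb{R})$ is the real Heisenberg group of triples $[a,c,z]\in\mathbb{R}^3$ with law $[a,c,z]\circ[a',c',z']=[a+a',c+c',z+z'+ca']$ and Haar measure $d\mu=da\,dc\,dz$; $H(\mathbb{Z})$ is the subgroup of integer triples. $\mathcal{H}=L^2(H(\mathbb{Z})\backslash H(\mathbb{R}),d\mu)$ is the Hilbert space of (classes of) measurable functions $F$ on $H(\mathbb{R})$ with $F(\gamma g)=F(g)$ for $\gamma\in H(\mathbb{Z})$, square-integrable over $[0,1]^3$, with inner product $\int_0^1\int_0^1\int_0^1F_1\overline{F_2}\,da\,dc\,dz$. For $N\in\mathbb{Z}$, $\mathcal{H}_N\subset\mathcal{H}$ is the closed subspace of $F$ with $F(a,c,z)=e^{2\pi i Nz}F(a,c,0)$ a.e.; $\mathcal{H}=\bigoplus_N\mathcal{H}_N$. The two-variable Hecke operator is the bounded operator on $\mathcal{H}$ given by $T_m(F)(a,c,z)=\frac1{m}\sum_{j=0}^{m-1}F(\frac{a+j}{m},mc,z)$. The Heisenberg–Fourier operator is the unitary operator $R(F)(a,c,z)=F(-c,a,z-ac)$ on $\mathcal{H}$, which satisfies $R^4=\mathbf{I}$. Convention: $\gcd(m,0)=m$. *)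

(* Defs.v *)
From HB Require Import structures.
From mathcomp Require Export all_boot all_order all_algebra.
From mathcomp Require Export complex.
From mathcomp Require Export all_classical all_reals all_analysis.

Set Implicit Arguments.
Unset Strict Implicit.
Unset Printing Implicit Defensive.

Export Order.TTheory GRing.Theory Num.Theory.
Export numFieldNormedType.Exports.

Global Open Scope classical_set_scope.
Global Open Scope ring_scope.
Global Open Scope complex_scope.


(* The point [a, c, z] of H(R) is the triple (a, c, z), i.e. ((a, c), z). *)
Definition heis_mul (R : realType) (g h : R * R * R) : R * R * R :=
  let: (a, c, z) := g in
  let: (a', c', z') := h in
  (a + a', c + c', z + z' + c * a').

Definition heis_lattice (R : realType) : set (R * R * R) :=
  [set g | exists p q r : int, g = (p%:~R, q%:~R, r%:~R)].

Definition haar (R : realType) :=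
  ((@lebesgue_measure R \x @lebesgue_measure R) \x @lebesgue_measure R)%E.

Definition unit_cube (R : realType) : set (R * R * R) :=
  [set` `[(0 : R), 1]] `*` [set` `[(0 : R), 1]] `*` [set` `[(0 : R), 1]].

Definition expi2pi (R : realType) (t : R) : R[i] :=
  cos (2 * pi * t) +i* sin (2 * pi * t).

(* R[i] carries no sigma-algebra or integral in the library; both are taken
   through real and imaginary parts. *)
Definition cmeasurable (R : realType) (F : R * R * R -> R[i]) : Prop :=
  measurable_fun setT (fun g => complex.Re (F g)) /\
  measurable_fun setT (fun g => complex.Im (F g)).

Definition cintegral (R : realType) (D : set (R * R * R))
    (F : R * R * R -> R[i]) : R[i] :=
  Rintegral (@haar R) D (fun g => complex.Re (F g)) +i*
  Rintegral (@haar R) D (fun g => complex.Im (F g)).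

(* Elements of the Hilbert space are represented by functions; two functions
   represent the same element when they agree Haar-almost everywhere. *)
Definition inH (R : realType) (F : R * R * R -> R[i]) : Prop :=
  [/\ cmeasurable F,
      forall gamma g, heis_lattice gamma -> F (heis_mul gamma g) = F g
    & (\int[@haar R]_(g in @unit_cube R) ((Normc.normc (F g)) ^+ 2)%:E < +oo)%E].

Notation "F1 =ae F2" := (ae_eq (@haar _) setT F1 F2) (at level 70).

Definition inner (R : realType) (F1 F2 : R * R * R -> R[i]) : R[i] :=
  cintegral (@unit_cube R) (fun g => F1 g * (F2 g)^*).

(* The value F (a, c, 0) lives on a null set, so the condition defining H_N is
   a condition on a suitable representative of the class of F. *)
Definition inHN (R : realType) (N : int) (F : R * R * R -> R[i]) : Prop :=
  inH F /\
  exists F0, [/\ inH F0, F =ae F0 &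
    F0 =ae (fun g => let: (a, c, z) := g in
              expi2pi (N%:~R * z) * F0 (a, c, 0))].

Definition hecke (R : realType) (m : nat) (F : R * R * R -> R[i]) :
    R * R * R -> R[i] :=
  fun g => let: (a, c, z) := g in
    m%:R^-1 * \sum_(j < m) F ((a + j%:R) / m%:R, m%:R * c, z).

Definition fourier (R : realType) (F : R * R * R -> R[i]) :
    R * R * R -> R[i] :=
  fun g => let: (a, c, z) := g in F (- c, a, z - a * c).

Definition is_adjoint (R : realType)
    (T S : (R * R * R -> R[i]) -> (R * R * R -> R[i])) : Prop :=
  (forall F, inH F -> inH (S F)) /\
  (forall F G, inH F -> inH G -> inner (T F) G = inner F (S G)).

(* The adjoint; is_adjoint determines its values on inH almost everywhere.
   The default value idfun is irrelevant when an adjoint exists. *)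
Definition adjoint (R : realType)
    (T : (R * R * R -> R[i]) -> (R * R * R -> R[i])) :
    (R * R * R -> R[i]) -> (R * R * R -> R[i]) :=
  xget (idfun : (R * R * R -> R[i]) -> (R * R * R -> R[i])) [set S | is_adjoint T S].

Definition commute_on (R : realType) (D : set (R * R * R -> R[i]))
    (S T : (R * R * R -> R[i]) -> (R * R * R -> R[i])) : Prop :=
  forall F, D F -> S (T F) =ae T (S F).

(* Main.v *)
From HB Require Import structures.
Require Import Defs.
From mathcomp Require Import measurable_realfun ring lra zify.

(** Everything rests on an explicit adjoint of [T_m] on the whole Hilbert space,

      [S F (a, c, z) = 1/m sum_(k < m) F (m a, (c + k)/m, z + k a)]

    ([hecke_star]).  Put [K (a, c, z) = F (a, m c, z) conj (G (m a, c, z))].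
    Invariance of [G] under [a -> a + 1] turns the integrand of [<T_m F, G>]
    into the average of [K] over the maps [((a + j)/m, c, z)], and invariance of
    [F] under [(a, c, z) -> (a, c + 1, z + a)] turns that of [<F, S G>] into the
    average of [K] over the maps [(a, (c + k)/m, z + k a)].  Each family cuts a
    unit interval into [m] equal pieces, so both averages have the integral of
    [K] over the cube; the shear in [z] is invisible once one integrates over
    the circle [z], and after that integration [K] is doubly periodic in
    [(a, c)].  This is [is_adjoint_hecke]; the same method, with a rotation of
    the [(a, c)] plane, gives that [R^3] is the adjoint of [R]
    ([is_adjoint_fourier]).  The changes of variables are proved for nonnegative
    functions by Tonelli, then passed to positive and negative parts
    ([cintegral_comp]).

    Two adjoints of one operator agree almost everywhere: testing against their
    difference [D] gives [<D, D> = 0], so [D] vanishes almost everywhere on the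
    cube, hence, by invariance, everywhere ([adjoint_unique]).  So every
    statement about the adjoint is one about [S], and [S = R^3 T_m R] is a
    pointwise identity ([hecke_starE]), which is part (ii).

    An element of [H_N] has a representative that is exactly invariant and
    satisfies [F (a, c, z + t) = e(N t) F (a, c, z)] at every point
    ([inHN_central]).  On it [S] is the formula of part (i), and the two
    compositions in part (iii) are double sums over [j, k < m] in which one
    index occurs only in a character [e(N j k / m)]; orthogonality of characters
    keeps the other index exactly when it is a multiple of [m / d].  The
    formulas return to the given function since every map involved is
    nonsingular, that is, pulls null sets back to null sets.

    When [d > 1], extend the indicator of [0 <= a < 1/d] to an element of [H_N].
    For [1/d <= a < 2/d] translations in [c] leave it zero, whereas exactly one
    of the translations [a + l/d] brings it back to modulus one; so the two
    composites differ on a set of positive measure ([hecke_not_commute]). *)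

Set Implicit Arguments.
Unset Strict Implicit.
Unset Printing Implicit Defensive.

Local Notation Re := complex.Re.
Local Notation Im := complex.Im.


(** * Affine changes of variable on the line *)

Lemma measurable_affine (R : realType) (p q : R) :
  measurable_fun setT (fun x : R => p * x + q).
Proof. by apply: measurable_funD => //; exact: mulrl_measurable. Qed.

Lemma affine_preimage_itvoc (R : realType) (p q a b : R) : p != 0 ->
  (fun x => p * x + q) @^-1` `]a, b]%classic =
  if 0 < p then `](a - q) / p, (b - q) / p]%classic
  else `[(b - q) / p, (a - q) / p[%classic.
Proof.
move=> p0; apply/seteqP.
have [pp|pn] := ltP 0 p; last move: pn; last rewrite le_eqVlt (negPf p0)/= => pn.
  by split=> x; rewrite /= !in_itv/= ltr_pdivrMr// ler_pdivlMr// ltrBlDr lerBrDr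
    (mulrC x).
by split=> x; rewrite /= !in_itv/= ler_ndivrMr// ltr_ndivlMr// lerBrDr ltrBlDr
  (mulrC x) andbC.
Qed.

(** A Borel measure that agrees with Lebesgue measure on half-open intervals is
    Lebesgue measure; this is applied to the rescaled image measure. *)
Lemma lebesgue_measure_affine (R : realType) (p q : R) (A : set R) : p != 0 ->
  measurable A ->
  lebesgue_measure ((fun x => p * x + q) @^-1` A) =
  (`|p|^-1%:E * lebesgue_measure A)%E.
Proof.
move=> p0 mA.
have p0' : 0 < `|p| by rewrite normr_gt0.
pose phi := (fun x => p * x + q) : measurableTypeR R -> measurableTypeR R.
have mphi : measurable_fun setT phi by exact: measurable_affine.
pose nn : {nonneg R} := NngNum (normr_ge0 p).
have [pf pfE] : exists pf : {measure set (measurableTypeR R) -> \bar R},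
    forall B, pf B = lebesgue_measure (phi @^-1` B).
  by exists (measure_function_pushforward__canonical__measure_function_Measure
    lebesgue_measure mphi).
pose nu := mscale nn pf.
have -> : lebesgue_measure A = nu A.
  apply: (@lebesgue_measure_unique R nu) => // _ [[a b] _ <-] /=.
  rewrite /nu /mscale/= pfE.
  have -> : phi @^-1` `]a, b]%classic = _ := affine_preimage_itvoc q a b p0.
  case: ifPn => [pp|]; rewrite !lebesgue_measure_itv/= !lte_fin.
    rewrite ltr_pM2r ?invr_gt0// ltrD2r; case: ifPn => _; last by rewrite mule0.
    rewrite -EFinD -EFinM gtr0_norm//; congr EFin; field; lra.
  rewrite -leNgt le_eqVlt (negPf p0)/= => pn.
  rewrite ltr_nM2r ?invr_lt0// ltrD2r; case: ifPn => _; last by rewrite mule0.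
  rewrite -EFinD -EFinM ltr0_norm//; congr EFin; field; lra.
rewrite /nu /mscale/= pfE muleA -EFinM mulVf ?mul1e//.
by rewrite lt0r_neq0.
Qed.

Lemma ge0_integral_affine (R : realType) (p q : R) (D : set R) (f : R -> \bar R) :
  p != 0 -> measurable D -> measurable_fun setT f -> (forall x, 0 <= f x)%E ->
  (\int[lebesgue_measure]_(x in (fun x => p * x + q)%R @^-1` D) f (p * x + q)%R =
   `|p|^-1%:E * \int[lebesgue_measure]_(x in D) f x)%E.
Proof.
move=> p0 mD mf f0.
pose phi := (fun x => p * x + q) : measurableTypeR R -> measurableTypeR R.
have mphi : measurable_fun setT phi by exact: measurable_affine.
have ip : 0 <= `|p|^-1 by rewrite invr_ge0.
pose nn : {nonneg R} := NngNum ip.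
transitivity (\int[mscale nn (@lebesgue_measure R)]_(x in D) f x)%E; last first.
  by rewrite ge0_integral_mscale//; exact: measurable_funTS.
etransitivity; first apply/esym.
  exact: (@ge0_integral_pushforward _ _ (measurableTypeR R) _ R phi mphi
    (@lebesgue_measure R) D f mD (measurable_funTS mf) (fun x _ => f0 x)).
apply: eq_measure_integral => //= A mA AS.
exact: lebesgue_measure_affine.
Qed.

(** * Integration of periodic functions over a circle *)

(** Meant for functions of period [1]: an integral over the circle [R/Z]. *)
Definition circle_int (R : realType) (f : R -> \bar R) : \bar R :=
  (\int[lebesgue_measure]_(x in `[0%R, 1%R]) f x)%E.

Lemma circle_int_co (R : realType) (f : R -> \bar R) : measurable_fun setT f ->
  circle_int f = (\int[lebesgue_measure]_(x in `[0%R, 1%R[) f x)%E.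
Proof.
by move=> mf; rewrite /circle_int -integral_itv_bndo_bndc//; exact: measurable_funTS.
Qed.

Lemma eq_circle_int (R : realType) (f g : R -> \bar R) :
  f =1 g -> circle_int f = circle_int g.
Proof. by move=> fg; apply: eq_integral => x _. Qed.

Lemma circle_int_ge0 (R : realType) (f : R -> \bar R) : (forall x, 0 <= f x)%E ->
  (0 <= circle_int f)%E.
Proof. by move=> f0; apply: integral_ge0. Qed.

Lemma circle_int_sum (R : realType) (I : Type) (s : seq I) (f : I -> R -> \bar R) :
  (forall i, measurable_fun setT (f i)) -> (forall i x, 0 <= f i x)%E ->
  (circle_int (fun x => \sum_(i <- s) f i x) = \sum_(i <- s) circle_int (f i))%E.
Proof.
move=> mf f0; rewrite /circle_int; apply: ge0_integral_sum.
- by [].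
- by move=> i; apply: measurable_funTS; exact: mf.
- by [].
Qed.

Lemma ge0_integral_itv_cat (R : realType) (f : R -> \bar R) (a b c : R) :
  measurable_fun setT f -> (forall x, 0 <= f x)%E -> a <= b -> b <= c ->
  (\int[lebesgue_measure]_(x in `[a, b[) f x +
   \int[lebesgue_measure]_(x in `[b, c[) f x =
   \int[lebesgue_measure]_(x in `[a, c[) f x)%E.
Proof.
move=> mf f0 ab bc; rewrite -ge0_integral_setU//=.
- by rewrite -itv_bndbnd_setU.
- exact: measurable_funTS.
- apply/disj_setPS => x /=; rewrite !in_itv/= => -[/andP[_ xb] /andP[bx _]].
  by move: (lt_le_trans xb bx); rewrite ltxx.
Qed.

Lemma ge0_integral_affine_itv (R : realType) (p q a b : R) (f : R -> \bar R) :
  0 < p -> measurable_fun setT f -> (forall x, 0 <= f x)%E ->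
  (\int[lebesgue_measure]_(x in `[a, b[) f (p * x + q)%R =
   p^-1%:E * \int[lebesgue_measure]_(x in `[(p * a + q)%R, (p * b + q)%R[) f x)%E.
Proof.
move=> p0 mf f0; have -> : p^-1 = `|p|^-1 by rewrite gtr0_norm.
rewrite -(ge0_integral_affine q) ?gt_eqF//.
congr (integral _ _ _); apply/seteqP; split=> x /=;
  by rewrite !in_itv/= lerD2r ltrD2r ler_pM2l// ltr_pM2l.
Qed.

(** The [m] maps [x |-> (x + j) / m] cut the unit interval into [m] pieces, so
    the pull-backs of any function along them have total integral [m] times
    the original one. *)
Lemma circle_int_sum_divn (R : realType) (m : nat) (f : R -> \bar R) : (0 < m)%N ->
  measurable_fun setT f -> (forall x, 0 <= f x)%E ->
  (\sum_(j < m) circle_int (fun x => f ((x + j%:R) / m%:R)%R) = m%:R%:E * circle_int f)%E.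
Proof.
move=> m0 mf f0.
have m0' : 0 < m%:R :> R by rewrite ltr0n.
pose J (j : nat) := `[(j%:R / m%:R : R), (j.+1%:R / m%:R)[%classic.
have piece (j : nat) : circle_int (fun x => f ((x + j%:R) / m%:R)) =
    (m%:R%:E * \int[lebesgue_measure]_(x in J j) f x)%E.
  rewrite circle_int_co; last first.
    apply: (measurableT_comp mf).
    by apply: measurable_funM => //; apply: measurable_funD.
  under eq_integral do rewrite mulrDl (mulrC _ m%:R^-1).
  rewrite ge0_integral_affine_itv ?invr_gt0// invrK mulr0 add0r mulr1.
  by rewrite /J -[j.+1%:R]natr1 mulrDl mul1r addrC.
under eq_bigr do rewrite piece.
rewrite -ge0_sume_distrr => [|j _]; last exact: integral_ge0.
congr (_ * _)%E; rewrite circle_int_co//.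
have -> (k : nat) : (\sum_(j < k) \int[lebesgue_measure]_(x in J j) f x)%E =
    (\int[lebesgue_measure]_(x in `[0%R, (k%:R / m%:R)%R[) f x)%E.
  elim: k => [|k IH]; first by rewrite big_ord0 mul0r set_itvco0 integral_set0.
  rewrite big_ord_recr/= IH /J ge0_integral_itv_cat// ?divr_ge0//.
  by rewrite ler_pM2r ?invr_gt0// ler_nat.
by rewrite divff// gt_eqF.
Qed.

Definition periodic1 (R : realType) (T : Type) (f : R -> T) :=
  forall x, f (x + 1) = f x.

Lemma periodic1_nat (R : realType) (T : Type) (f : R -> T) (n : nat) x :
  periodic1 f -> f (x + n%:R) = f x.
Proof.
move=> pf; elim: n => [|n IH]; first by rewrite addr0.
by rewrite -natr1 addrA pf.
Qed.

Lemma periodic1_int (R : realType) (T : Type) (f : R -> T) (n : int) x :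
  periodic1 f -> f (x + n%:~R) = f x.
Proof.
move=> pf; case: n => n; first by rewrite -pmulrn periodic1_nat.
rewrite NegzE mulrNz -pmulrn.
by rewrite -[in RHS](subrK n.+1%:R x) (periodic1_nat n.+1).
Qed.

(** Periodicity reduces to a translation [s] in [[0, 1]]; the part of
    [[s, s + 1[] that sticks out of the unit interval is then moved back by one
    period. *)
Lemma circle_int_translate (R : realType) (t : R) (f : R -> \bar R) :
  measurable_fun setT f -> (forall x, 0 <= f x)%E -> periodic1 f ->
  circle_int (fun x => f (x + t)) = circle_int f.
Proof.
move=> mf f0 pf; pose s := t - (Num.floor t)%:~R.
have s0 : 0 <= s by rewrite subr_ge0 ge_floor.
have s1 : s <= 1.
  by rewrite lerBlDr addrC -intrD1 ltW// floorD1_gt.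
have -> : circle_int (fun x => f (x + t)) = circle_int (fun x => f (x + s)).
  by apply: eq_circle_int => x; rewrite -(periodic1_int (Num.floor t) (x + s) pf) -addrA subrK.
have shift (a b u : R) :
    (\int[lebesgue_measure]_(x in `[a, b[) f (x + u)%R =
     \int[lebesgue_measure]_(x in `[(a + u)%R, (b + u)%R[) f x)%E.
  have := ge0_integral_affine_itv u a b ltr01 mf f0.
  rewrite invr1 mul1e !mul1r => <-.
  by apply: eq_integral => x _; rewrite mul1r.
rewrite !circle_int_co//; last first.
  by apply: (measurableT_comp mf); exact: measurable_funD.
rewrite shift add0r -(@ge0_integral_itv_cat _ _ s 1)//; last by rewrite lerDl.
rewrite -(@ge0_integral_itv_cat _ _ 0 s 1)// addeC.
congr (_ + _)%E; rewrite -{1}(add0r 1) (addrC 1) -shift.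
by apply: eq_integral => x _.
Qed.

(** By periodicity [- x] may be replaced by [1 - x], which preserves the unit
    interval. *)
Lemma circle_int_reflect (R : realType) (f : R -> \bar R) :
  measurable_fun setT f -> (forall x, 0 <= f x)%E -> periodic1 f ->
  circle_int (fun x => f (- x)) = circle_int f.
Proof.
move=> mf f0 pf.
have -> : circle_int (fun x => f (- x)) = circle_int (fun x => f (- 1 * x + 1)).
  by apply: eq_circle_int => x; rewrite mulN1r pf.
have N1 : (-1 : R) != 0 by rewrite oppr_eq0.
have := ge0_integral_affine 1 N1 (measurable_itv `[0, 1]) mf f0.
rewrite normrN1 invr1 mul1e -[RHS]/(circle_int f) => <-.
congr (integral _ _ _); apply/seteqP; split=> x /=;
  by rewrite !in_itv/= mulN1r addrC subr_ge0 lerBlDr lerDl andbC.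
Qed.

Lemma sume_ord_cst (R : realType) (n : nat) (x : \bar R) : (0 <= x)%E ->
  (\sum_(i < n) x = n%:R%:E * x)%E.
Proof.
move=> x0; elim: n => [|n IH]; first by rewrite big_ord0 mul0e.
by rewrite big_ord_recr/= IH -natr1 EFinD ge0_muleDl ?lee_fin// mul1e.
Qed.

(** Apply the decomposition into [m] pieces to [x |-> f (m x)]: on each piece
    it restores [f], so the [m] integrals on the left are equal. *)
Lemma circle_int_muln (R : realType) (m : nat) (f : R -> \bar R) : (0 < m)%N ->
  measurable_fun setT f -> (forall x, 0 <= f x)%E -> periodic1 f ->
  circle_int (fun x => f (m%:R * x)) = circle_int f.
Proof.
move=> m0 mf f0 pf; have mR : m%:R != 0 :> R by rewrite pnatr_eq0 -lt0n.
have := @circle_int_sum_divn R m (fun x => f (m%:R * x)) m0.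
have mm : measurable_fun setT (fun x : R => f (m%:R * x)).
  by apply: (measurableT_comp mf); exact: mulrl_measurable.
move=> /(_ mm (fun x => f0 _)).
have -> : (\sum_(j < m) circle_int (fun x => f (m%:R * ((x + j%:R) / m%:R))%R)
    = \sum_(j < m) circle_int f)%E.
  apply: eq_bigr => j _; apply: eq_circle_int => x.
  by rewrite mulrC divfK// periodic1_nat.
rewrite sume_ord_cst ?circle_int_ge0// => /(congr1 (mule (m%:R^-1)%:E)).
by rewrite !muleA -EFinM mulVf// !mul1e => ->.
Qed.

(** * Integration over the unit cube *)

Lemma measurable_erestrict d (T : measurableType d) (R : realType) (D : set T)
    (f : T -> \bar R) :
  measurable D -> measurable_fun setT f -> measurable_fun setT (f \_ D).
Proof.
move=> mD mf; apply: (measurable_restrictT f mD).1.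
exact: measurable_funTS.
Qed.

Lemma measurable_integral_snd d1 d2 (T1 : measurableType d1)
    (T2 : measurableType d2) (R : realType)
    (m2 : {sigma_finite_measure set T2 -> \bar R}) (B : set T2)
    (f : T1 * T2 -> \bar R) :
  measurable B -> measurable_fun setT f -> (forall p, 0 <= f p)%E ->
  measurable_fun setT (fun x => \int[m2]_(y in B) f (x, y))%E.
Proof.
move=> mB mf f0.
pose g := f \_ (setT `*` B).
have mg : measurable_fun setT g.
  by apply: measurable_erestrict => //; exact: measurableX.
have g0 p : (0 <= g p)%E by rewrite /g erestrict_ge0.
have := measurable_fun_fubini_tonelli_F (m2 := m2) g mg g0.
congr (measurable_fun _ _); apply/funext => x.
rewrite /fubini_F [RHS]integral_mkcond; apply: eq_integral => y _.
by rewrite /g /patch; congr (if _ then _ else _); apply/idP/idP; rewrite !inE//= => -[].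
Qed.

(** Tonelli over a rectangle; the restriction of the integrand to the rectangle
    is a product of restrictions. *)
Lemma ge0_integral_setX d1 d2 (T1 : measurableType d1)
    (T2 : measurableType d2) (R : realType)
    (m1 : {sigma_finite_measure set T1 -> \bar R})
    (m2 : {sigma_finite_measure set T2 -> \bar R}) (A : set T1) (B : set T2)
    (f : T1 * T2 -> \bar R) :
  measurable A -> measurable B ->
  measurable_fun setT f -> (forall p, 0 <= f p)%E ->
  (\int[(m1 \x m2)%E]_(p in A `*` B) f p =
   \int[m1]_(x in A) \int[m2]_(y in B) f (x, y))%E.
Proof.
move=> mA mB mf f0; rewrite integral_mkcond fubini_tonelli1; last 2 first.
- by apply: measurable_erestrict => //; exact: measurableX.
- by move=> p; rewrite erestrict_ge0.
rewrite [RHS]integral_mkcond; apply: eq_integral => x _.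
rewrite /fubini_F [RHS]/patch; case: ifPn => xA.
  rewrite [RHS]integral_mkcond; apply: eq_integral => y _.
  rewrite /patch; congr (if _ then _ else _).
  apply/idP/idP; rewrite !inE/=; first by case.
  by move=> By; split => //; exact: set_mem.
apply: integral0_eq => y _; rewrite patchE ifF//; apply/negbTE.
by apply: contra xA; rewrite !inE => -[].
Qed.

Lemma measurable_circle_int_snd d (T : measurableType d) (R : realType)
    (f : T * R -> \bar R) :
  measurable_fun setT f -> (forall p, 0 <= f p)%E ->
  measurable_fun setT (fun x => circle_int (fun y => f (x, y))).
Proof. by move=> mf f0; exact: measurable_integral_snd. Qed.

Lemma circle_int_swap (R : realType) (f : R -> R -> \bar R) :
  measurable_fun setT (fun p : R * R => f p.1 p.2) ->
  (forall x y, 0 <= f x y)%E ->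
  circle_int (fun x => circle_int (fun y => f x y)) = circle_int (fun y => circle_int (fun x => f x y)).
Proof.
move=> mf f0.
pose g := (fun p : R * R => f p.1 p.2) \_ (`[0%R, 1%R]%classic `*` `[0%R, 1%R]%classic).
have mg : measurable_fun setT g.
  by apply: measurable_erestrict => //; exact: measurableX.
have g0 p : (0 <= g p)%E by rewrite /g erestrict_ge0.
have := @fubini_tonelli _ _ _ _ R (@lebesgue_measure R) (@lebesgue_measure R) g mg g0.
have E x y : g (x, y) = if (x \in `[0%R, 1%R]%classic) && (y \in `[0%R, 1%R]%classic) then f x y else 0%E.
  rewrite /g patchE; congr (if _ then _ else _).
  by rewrite in_setX.
have L x : (\int[lebesgue_measure]_y g (x, y))%E =
    ((fun x => circle_int (fun y => f x y)) \_ `[0%R, 1%R]) x.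
  rewrite patchE; case: ifPn => xI.
    by rewrite /circle_int [RHS]integral_mkcond; apply: eq_integral => y _; rewrite E xI patchE.
  by apply: integral0_eq => y _; rewrite E (negPf xI).
have L' y : (\int[lebesgue_measure]_x g (x, y))%E =
    ((fun y => circle_int (fun x => f x y)) \_ `[0%R, 1%R]) y.
  rewrite patchE; case: ifPn => yI.
    by rewrite /circle_int [RHS]integral_mkcond; apply: eq_integral => x _; rewrite E yI patchE andbT.
  by apply: integral0_eq => x _; rewrite E (negPf yI) andbF.
under eq_integral do rewrite L; under [in RHS]eq_integral do rewrite L'.
by rewrite -!integral_mkcond.
Qed.

(** Lebesgue measure on the plane, named so as to carry the sigma-finite
    structure that iterated integration in three variables requires. *)
Definition plane (R : realType) :
    set (measurableTypeR R * measurableTypeR R) -> \bar R :=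
  (@lebesgue_measure R \x @lebesgue_measure R)%E.

HB.instance Definition _ (R : realType) := Measure.on (@plane R).

Lemma plane_sigma_finite (R : realType) : sigma_finite setT (@plane R).
Proof.
pose I (n : nat) := `[- n%:R : R, n%:R]%classic.
have II n : measurable (I n) by exact: measurable_itv.
exists (fun n => I n `*` I n).
  apply/seteqP; split => // -[x y] _.
  have [n [xn yn]] : exists n : nat, `|x| <= n%:R /\ `|y| <= n%:R.
    exists (maxn (Num.bound `|x|) (Num.bound `|y|)).
    by rewrite -!maxEnat !natr_max !le_max !(ltW (archi_boundP (normr_ge0 _))) ?orbT.
  by exists n => //; split; rewrite /I/= in_itv/= -ler_norml.
move=> n; split; first exact: measurableX (II n) (II n).
have In : lebesgue_measure (I n) \is a fin_num.
  by rewrite lebesgue_measure_itv/=; case: ifP.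
rewrite -ge0_fin_numE//.
rewrite [X in X \is a fin_num](product_measure1E (@lebesgue_measure R)
  (@lebesgue_measure R) (II n) (II n)).
exact: fin_numM.
Qed.

HB.instance Definition _ (R : realType) :=
  Measure_isSigmaFinite.Build _ _ _ (@plane R) (@plane_sigma_finite R).

Definition cube_int (R : realType) (K : R * R * R -> \bar R) : \bar R :=
  circle_int (fun a => circle_int (fun c => circle_int (fun z => K (a, c, z)))).

Lemma integral_unit_cube (R : realType) (K : R * R * R -> \bar R) :
  measurable_fun setT K -> (forall g, 0 <= K g)%E ->
  (\int[@haar R]_(g in @unit_cube R) K g)%E = cube_int K.
Proof.
move=> mK K0.
have mI := measurable_itv `[0 : R, 1].
etransitivity.
  exact: (@ge0_integral_setX _ _ _ _ R (@plane R) (@lebesgue_measure R)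
    ([set` `[(0 : R), 1]] `*` [set` `[(0 : R), 1]]) [set` `[(0 : R), 1]] K
    (measurableX mI mI) mI mK K0).
exact: (@ge0_integral_setX _ _ _ _ R (@lebesgue_measure R) (@lebesgue_measure R)
  [set` `[(0 : R), 1]] [set` `[(0 : R), 1]] (fun p => circle_int (fun z => K (p, z)))
  mI mI (measurable_circle_int_snd mK K0) (fun p => circle_int_ge0 (fun z => K0 _))).
Qed.

(** The symmetry shared by [H(Z)]-invariant functions (case [k = 1]) and by the
    functions [K (a, m c, z)] and [K (m a, c, z)] built from them (case
    [k = m]).  It is weak enough to be stable under these operations and
    strong enough for the integral over a fibre [z in [0, 1]] to be a doubly
    periodic function of [(a, c)]. *)
Definition twisted (R : realType) (T : Type) (k : nat) (K : R * R * R -> T) :=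
  [/\ forall a c z, K (a + 1, c, z) = K (a, c, z),
      forall a c z, K (a, c + 1, z) = K (a, c, z - k%:R * a)
    & forall a c z, K (a, c, z + 1) = K (a, c, z)].

(** The maps of the two averages that compute [<T_m F, G>]. *)
Definition contract1 (R : realType) (m : nat) (j : 'I_m) (g : R * R * R) :
    R * R * R :=
  ((g.1.1 + j%:R) / m%:R, g.1.2, g.2).
Definition contract2 (R : realType) (m : nat) (j : 'I_m) (g : R * R * R) :
    R * R * R :=
  (g.1.1, (g.1.2 + j%:R) / m%:R, g.2 + j%:R * g.1.1).
Definition dilate1 (R : realType) (m : nat) (g : R * R * R) : R * R * R :=
  (m%:R * g.1.1, g.1.2, g.2).
Definition dilate2 (R : realType) (m : nat) (g : R * R * R) : R * R * R :=
  (g.1.1, m%:R * g.1.2, g.2).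

Definition heis_rotation (R : realType) (g : R * R * R) : R * R * R :=
  (- g.1.2, g.1.1, g.2 - g.1.1 * g.1.2).

(** The integral [B (a, c)] over the fibre is doubly periodic: the twist in [z]
    acquired when [c] increases by [1] is a translation of the fibre.  Each
    identity below is then a statement about periodic functions of one
    variable. *)
Section twisted_integrals.
Context (R : realType) (K : R * R * R -> \bar R) (k : nat).
Hypotheses (mK : measurable_fun setT K) (K0 : forall g, (0 <= K g)%E).
Hypothesis tK : twisted k K.

Let B (p : R * R) := circle_int (fun z => K (p, z)).

Let mB : measurable_fun setT B. Proof. exact: measurable_circle_int_snd. Qed.
Let B0 p : (0 <= B p)%E. Proof. exact: circle_int_ge0. Qed.

Let mBr a : measurable_fun setT (fun c => B (a, c)).
Proof. exact: (measurableT_comp mB). Qed.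

Let mBl c : measurable_fun setT (fun a => B (a, c)).
Proof. exact: (measurableT_comp mB). Qed.

Let fiber_translate p t : circle_int (fun z => K (p, z + t)) = B p.
Proof.
case: p => a c; apply: (@circle_int_translate _ t (fun z => K (a, c, z))) => //.
  exact: (measurableT_comp mK).
by move=> z; case: tK.
Qed.

Let Bl c : periodic1 (fun a => B (a, c)).
Proof. by move=> a; apply: eq_circle_int => z; case: tK. Qed.

Let Br a : periodic1 (fun c => B (a, c)).
Proof.
move=> c; rewrite -(fiber_translate (a, c) (- (k%:R * a))).
by apply: eq_circle_int => z; case: tK.
Qed.

Let b a := circle_int (fun c => B (a, c)).
Let mb : measurable_fun setT b. Proof. exact: measurable_circle_int_snd. Qed.
Let b0 a : (0 <= b a)%E. Proof. exact: circle_int_ge0. Qed.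
Let pb : periodic1 b. Proof. by move=> a; apply: eq_circle_int => c; exact: Bl. Qed.

Lemma cube_int_sum_contract1 m : (0 < m)%N ->
  (\sum_(j < m) cube_int (K \o contract1 j) = m%:R%:E * cube_int K)%E.
Proof. by move=> m0; exact: (circle_int_sum_divn m0 mb b0). Qed.

Lemma cube_int_dilate1 m : (0 < m)%N ->
  cube_int (K \o dilate1 m) = cube_int K.
Proof. by move=> m0; exact: (circle_int_muln m0 mb b0). Qed.

Lemma cube_int_dilate2 m : (0 < m)%N ->
  cube_int (K \o dilate2 m) = cube_int K.
Proof.
move=> m0; apply: eq_circle_int => a.
exact: (circle_int_muln m0 (mBr a) (fun c => B0 (a, c)) (Br a)).
Qed.

Lemma cube_int_sum_contract2 m : (0 < m)%N ->
  (\sum_(j < m) cube_int (K \o contract2 j) = m%:R%:E * cube_int K)%E.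
Proof.
move=> m0.
pose h (j : 'I_m) a := circle_int (fun c => B (a, (c + j%:R) / m%:R)).
transitivity (\sum_(j < m) circle_int (h j))%E.
  apply: eq_bigr => j _; apply: eq_circle_int => a; apply: eq_circle_int => c.
  exact: (fiber_translate (a, (c + j%:R) / m%:R) (j%:R * a)).
have mh j : measurable_fun setT (h j).
  apply: (@measurable_circle_int_snd _ _ _ (fun p => B (p.1, (p.2 + j%:R) / m%:R))) => //.
  apply: (measurableT_comp mB); apply: measurable_fun_pair => //.
  by apply: measurable_funM => //; exact: measurable_funD.
rewrite -(circle_int_sum _ mh); last by move=> j a; exact: circle_int_ge0.
transitivity (circle_int (fun a => m%:R%:E * b a)%E).
  by apply: eq_circle_int => a; exact: (circle_int_sum_divn m0 (mBr a)).
by rewrite /circle_int ge0_integralZl//; exact: measurable_funTS.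
Qed.

Lemma cube_int_rotation : cube_int (K \o @heis_rotation R) = cube_int K.
Proof.
transitivity (circle_int (fun a => circle_int (fun c => B (- c, a)))).
  by apply: eq_circle_int => a; apply: eq_circle_int => c; exact: (fiber_translate (- c, a) (- (a * c))).
transitivity (circle_int (fun a => circle_int (fun c => B (c, a)))).
  by apply: eq_circle_int => a; exact: (circle_int_reflect (mBl a)).
apply: circle_int_swap => //; apply: (measurableT_comp mB).
exact: measurable_swap.
Qed.

End twisted_integrals.

(** * Maps that pull null sets back to null sets *)

Definition nonsingular d (T : measurableType d) (R : realType)
    (mu : set T -> \bar R) (phi : T -> T) :=
  measurable_fun setT phi /\
  forall A, measurable A -> mu A = 0%E -> mu (phi @^-1` A) = 0%E.

Lemma nonsingular_comp d (T : measurableType d) (R : realType)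
    (mu : set T -> \bar R) (phi psi : T -> T) :
  nonsingular mu phi -> nonsingular mu psi -> nonsingular mu (phi \o psi).
Proof.
move=> [mphi nphi] [mpsi npsi]; split; first exact: measurableT_comp.
move=> A mA A0; rewrite comp_preimage; apply: npsi; last exact: nphi.
by rewrite -[X in measurable X]setTI; exact: mphi.
Qed.

Lemma nonsingular_ae d (T : measurableType d) (R : realType)
    (mu : {measure set T -> \bar R}) (phi : T -> T) (P : T -> Prop) :
  nonsingular mu phi -> {ae mu, forall x, P x} -> {ae mu, forall x, P (phi x)}.
Proof.
move=> [mphi nphi] [A [mA A0 PA]]; exists (phi @^-1` A); split.
- by rewrite -[X in measurable X]setTI; exact: mphi.
- exact: nphi.
- by move=> x /= nP; exact: (PA (phi x)).
Qed.

(** A set is null for a product measure exactly when almost all its sections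
    are null; this reduces nonsingularity to one variable at a time. *)
Lemma product_measure1_eq0 d1 d2 (T1 : measurableType d1)
    (T2 : measurableType d2) (R : realType)
    (m1 : {sigma_finite_measure set T1 -> \bar R})
    (m2 : {sigma_finite_measure set T2 -> \bar R}) (A : set (T1 * T2)) :
  measurable A ->
  (m1 \x m2)%E A = 0%E <-> {ae m1, forall x, m2 (xsection A x) = 0%E}.
Proof.
move=> mA; have mf : measurable_fun setT (m2 \o xsection A).
  exact: measurable_fun_xsection.
have := ae_eq_integral_abs m1 measurableT mf.
rewrite (_ : (\int[m1]_x _)%E = (m1 \x m2)%E A); last first.
  by apply: eq_integral => x _; rewrite gee0_abs.
move=> ->; split=> H.
  by apply: filterS H => x /= /(_ I).
by apply: filterS H => x /= H _.
Qed.

Lemma nonsingular_skew d (T : measurableType d) (R : realType)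
    (mu : {sigma_finite_measure set T -> \bar R}) (h : T -> T)
    (k : T -> R -> R) :
  measurable_fun setT (fun p : T * R => k p.1 p.2) ->
  nonsingular mu h -> (forall x, nonsingular lebesgue_measure (k x)) ->
  nonsingular (mu \x @lebesgue_measure R)%E (fun p => (h p.1, k p.1 p.2)).
Proof.
move=> mk [mh nh] nk; set phi := fun p : T * R => _.
have mphi : measurable_fun setT phi.
  by apply: measurable_fun_pair => //; exact: (measurableT_comp mh).
split=> // A mA; rewrite !product_measure1_eq0//; last first.
  by rewrite -[X in measurable X]setTI; exact: mphi.
move=> /(nonsingular_ae (conj mh nh)); apply: filterS => x /= A0.
have -> : xsection (phi @^-1` A) x = k x @^-1` (xsection A (h x)).
  by apply/seteqP; split=> y; rewrite /xsection/= !inE.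
by apply: (nk x).2 A0; exact: measurable_xsection.
Qed.

Lemma nonsingular_affine (R : realType) (p q : R) : p != 0 ->
  nonsingular (@lebesgue_measure R) (fun x : R => p * x + q).
Proof.
move=> p0; split; first exact: measurable_affine.
by move=> A mA A0; rewrite lebesgue_measure_affine// A0 mule0.
Qed.

Lemma nonsingular_swap (R : realType) :
  nonsingular (@plane R)
    (fun p : R * R => (p.2, p.1)).
Proof.
split; first exact: measurable_swap.
move=> A mA A0; rewrite -A0.
have -> : plane A = (@lebesgue_measure R \x^ @lebesgue_measure R)%E A.
  apply: (@product_measure_unique _ _ _ _ R (@lebesgue_measure R)
    (@lebesgue_measure R) (@lebesgue_measure R \x^ @lebesgue_measure R)%E) => //.
  by move=> *; exact: product_measure2E.
by apply: eq_integral => x _ /=; congr (lebesgue_measure _).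
Qed.

(** The shape of all the substitutions in the operators except the rotation of
    the Fourier operator. *)
Definition skew (R : realType) (p q r s : R) (k : R * R -> R)
    (g : R * R * R) : R * R * R :=
  (p * g.1.1 + q, r * g.1.2 + s, g.2 + k g.1).

Lemma nonsingular_haar_skew (R : realType) (p q r s : R) (k : R * R -> R) :
  p != 0 -> r != 0 -> measurable_fun setT k ->
  nonsingular (@haar R) (skew p q r s k).
Proof.
move=> p0 r0 mk.
apply: (@nonsingular_skew _ _ R (@plane R)
  (fun x => (p * x.1 + q, r * x.2 + s)) (fun x z => z + k x)).
- apply: measurable_funD => //; exact: (measurableT_comp mk).
- apply: (@nonsingular_skew _ _ R (@lebesgue_measure R)
    (fun a => p * a + q) (fun _ c => r * c + s)).
  + exact: (measurableT_comp (measurable_affine r s)).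
  + exact: nonsingular_affine.
  + by move=> _; exact: nonsingular_affine.
- move=> x; have -> : (fun z => z + k x) = (fun z => 1 * z + k x).
    by apply/funext => z; rewrite mul1r.
  by apply: nonsingular_affine; exact: oner_neq0.
Qed.

Lemma nonsingular_rotation (R : realType) :
  nonsingular (@haar R) (@heis_rotation R).
Proof.
apply: (@nonsingular_skew _ _ R (@plane R)
  (fun x => (- x.2, x.1)) (fun x z => z - x.1 * x.2)).
- have mM : measurable_fun setT (fun x : R * R => x.1 * x.2).
    exact: measurable_funM.
  by apply: measurable_funB => //; exact: (measurableT_comp mM).
- have -> : (fun x : R * R => (- x.2, x.1)) =
      (fun x => (x.2, x.1)) \o (fun x => (1 * x.1 + 0, -1 * x.2 + 0)).
    by apply/funext => x /=; rewrite mulN1r mul1r !addr0.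
  apply: nonsingular_comp; first exact: nonsingular_swap.
  have N1 : (-1 : R) != 0 by rewrite oppr_eq0 oner_neq0.
  apply: (@nonsingular_skew _ _ R (@lebesgue_measure R)
    (fun a => 1 * a + 0) (fun _ c => -1 * c + 0)).
  + exact: (measurableT_comp (measurable_affine (-1) 0)).
  + by apply: nonsingular_affine; exact: oner_neq0.
  + by move=> _; exact: nonsingular_affine.
- move=> x.
  have -> : (fun z => z - x.1 * x.2) = (fun z => 1 * z + - (x.1 * x.2)).
    by apply/funext => z; rewrite mul1r.
  by apply: nonsingular_affine; exact: oner_neq0.
Qed.

(** * Measurability of complex-valued functions *)

Section complex_measurability.
Context (R : realType).
Implicit Types (F G : R * R * R -> R[i]) (phi : R * R * R -> R * R * R).

Lemma complexP (x y : R[i]) : Re x = Re y -> Im x = Im y -> x = y.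
Proof. by case: x => [a b]; case: y => [c d] /= -> ->. Qed.

Lemma ReD (x y : R[i]) : Re (x + y) = Re x + Re y.
Proof. by case: x; case: y. Qed.
Lemma ImD (x y : R[i]) : Im (x + y) = Im x + Im y.
Proof. by case: x; case: y. Qed.
Lemma ReM (x y : R[i]) : Re (x * y) = Re x * Re y - Im x * Im y.
Proof. by case: x; case: y. Qed.
Lemma ImM (x y : R[i]) : Im (x * y) = Re x * Im y + Im x * Re y.
Proof. by case: x; case: y. Qed.
Lemma ReJ (x : R[i]) : Re x^* = Re x. Proof. by case: x. Qed.
Lemma ImJ (x : R[i]) : Im x^* = - Im x. Proof. by case: x. Qed.

Lemma conj_sum (I : Type) (s : seq I) (f : I -> R[i]) :
  (\sum_(i <- s) f i)^* = \sum_(i <- s) (f i)^*.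
Proof.
elim/big_ind2 : _ => [|x1 x2 y1 y2 <- <-|//]; first exact: conjc0.
by apply: complexP; rewrite !(ReD, ImD, ReJ, ImJ)// opprD.
Qed.

Lemma Re_sum (I : Type) (s : seq I) (f : I -> R[i]) :
  Re (\sum_(i <- s) f i) = \sum_(i <- s) Re (f i).
Proof. by elim/big_ind2 : _ => // x1 x2 y1 y2 <- <-; rewrite ReD. Qed.

Lemma Im_sum (I : Type) (s : seq I) (f : I -> R[i]) :
  Im (\sum_(i <- s) f i) = \sum_(i <- s) Im (f i).
Proof. by elim/big_ind2 : _ => // x1 x2 y1 y2 <- <-; rewrite ImD. Qed.

Lemma natcE (n : nat) : n%:R = (n%:R : R)%:C.
Proof. by rewrite rmorph_nat. Qed.

Lemma invnatcE (n : nat) : n%:R^-1 = (n%:R^-1 : R)%:C.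
Proof. by rewrite natcE fmorphV. Qed.

Lemma conj_invnatM (n : nat) (x : R[i]) :
  conjc (n%:R^-1 * x) = n%:R^-1 * conjc x.
Proof.
by rewrite invnatcE; apply: complexP; rewrite !(ReM, ImM, ReJ, ImJ)/=; ring.
Qed.

(** The squared modulus as a real number, in the form used by [inH]. *)
Definition nsq (x : R[i]) : R := Normc.normc x ^+ 2.

Lemma nsqE x : nsq x = Re x ^+ 2 + Im x ^+ 2.
Proof. by case: x => a b; rewrite /nsq/= sqr_sqrtr// addr_ge0 ?sqr_ge0. Qed.

Lemma nsq_ge0 x : 0 <= nsq x. Proof. exact: sqr_ge0. Qed.

Lemma nsqM x y : nsq (x * y) = nsq x * nsq y.
Proof. by rewrite /nsq Normc.normcM exprMn. Qed.

Lemma nsqD x y : nsq (x + y) <= 2 * (nsq x + nsq y).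
Proof.
rewrite !nsqE ReD ImD.
have := sqr_ge0 (Re x - Re y); have := sqr_ge0 (Im x - Im y); nra.
Qed.

Lemma nsq_eq0 x : nsq x = 0 -> x = 0.
Proof. by move/eqP; rewrite sqrf_eq0 => /eqP/Normc.eq0_normc. Qed.

Lemma nsq_ReMJ x y : `|Re (x * y^*)| <= nsq x + nsq y.
Proof.
rewrite !nsqE ReM ReJ ImJ ler_norml.
have := sqr_ge0 (Re x - Re y); have := sqr_ge0 (Im x - Im y).
have := sqr_ge0 (Re x + Re y); have := sqr_ge0 (Im x + Im y).
by move=> *; apply/andP; split; nra.
Qed.

Lemma nsq_ImMJ x y : `|Im (x * y^*)| <= nsq x + nsq y.
Proof.
rewrite !nsqE ImM ReJ ImJ ler_norml.
have := sqr_ge0 (Re x - Im y); have := sqr_ge0 (Im x - Re y).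
have := sqr_ge0 (Re x + Im y); have := sqr_ge0 (Im x + Re y).
by move=> *; apply/andP; split; nra.
Qed.

Lemma cmeasurable_comp F phi : cmeasurable F -> measurable_fun setT phi ->
  cmeasurable (F \o phi).
Proof.
by move=> [mR mI] mphi; split; [exact: (measurableT_comp mR)|exact: (measurableT_comp mI)].
Qed.

Lemma cmeasurable_cst (x : R[i]) : cmeasurable (fun=> x).
Proof. by split; exact: measurable_cst. Qed.

Lemma cmeasurableD F G : cmeasurable F -> cmeasurable G ->
  cmeasurable (fun g => F g + G g).
Proof.
move=> [FR FI] [GR GI]; split.
  by under eq_fun do rewrite ReD; exact: measurable_funD.
by under eq_fun do rewrite ImD; exact: measurable_funD.
Qed.

Lemma cmeasurableM F G : cmeasurable F -> cmeasurable G ->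
  cmeasurable (fun g => F g * G g).
Proof.
move=> [FR FI] [GR GI]; split.
  by under eq_fun do rewrite ReM; apply: measurable_funB; exact: measurable_funM.
by under eq_fun do rewrite ImM; apply: measurable_funD; exact: measurable_funM.
Qed.

Lemma cmeasurableJ F : cmeasurable F -> cmeasurable (fun g => (F g)^*).
Proof.
move=> [FR FI]; split; first by under eq_fun do rewrite ReJ.
by under eq_fun do rewrite ImJ; exact: measurable_funN.
Qed.

Lemma measurable_nsq F : cmeasurable F -> measurable_fun setT (nsq \o F).
Proof.
move=> [FR FI]; rewrite /comp; under eq_fun do rewrite nsqE.
by apply: measurable_funD; exact: measurable_funX.
Qed.

Lemma cmeasurable_expi (f : R * R * R -> R) : measurable_fun setT f ->
  cmeasurable (fun g => expi2pi (f g)).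
Proof.
move=> mf; split => /=.
  apply: (measurableT_comp (f := cos)); last exact: measurable_funM.
  by apply: continuous_measurable_fun; exact: continuous_cos.
apply: (measurableT_comp (f := sin)); last exact: measurable_funM.
by apply: continuous_measurable_fun; exact: continuous_sin.
Qed.

Lemma measurable_triple d (T : measurableType d) (f1 f2 f3 : T -> R) :
  measurable_fun setT f1 -> measurable_fun setT f2 -> measurable_fun setT f3 ->
  measurable_fun setT (fun x => (f1 x, f2 x, f3 x)).
Proof.
by move=> m1 m2 m3; apply: measurable_fun_pair => //; exact: measurable_fun_pair.
Qed.

Lemma measurable_proj1 : measurable_fun setT (fun g : R * R * R => g.1.1).
Proof. exact: (measurableT_comp measurable_fst measurable_fst). Qed.
Lemma measurable_proj2 : measurable_fun setT (fun g : R * R * R => g.1.2).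
Proof. exact: (measurableT_comp measurable_snd measurable_fst). Qed.
Lemma measurable_proj3 : measurable_fun setT (fun g : R * R * R => g.2).
Proof. exact: measurable_snd. Qed.

End complex_measurability.

(** * Square-integrable functions on the unit cube *)

Section square_integrable.
Context (R : realType).
Implicit Types (F G : R * R * R -> R[i]) (phi : R * R * R -> R * R * R).

Lemma measurable_unit_cube : measurable (@unit_cube R :
  set (measurableTypeR R * measurableTypeR R * measurableTypeR R)).
Proof. by apply: measurableX => //; exact: measurableX. Qed.

Definition sqint F := cmeasurable F /\
  (\int[@haar R]_(g in @unit_cube R) (nsq (F g))%:E < +oo)%E.

Lemma measurable_nsqE F : cmeasurable F ->
  measurable_fun setT (fun g => (nsq (F g))%:E).
Proof. by move=> mF; apply/measurable_EFinP; exact: measurable_nsq. Qed.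

Lemma sqint_cube_int F : cmeasurable F ->
  sqint F <-> (cube_int (fun g => (nsq (F g))%:E) < +oo)%E.
Proof.
move=> mF; rewrite /sqint integral_unit_cube; [by split=> [[]|]|exact: measurable_nsqE|].
by move=> g; rewrite lee_fin nsq_ge0.
Qed.

Lemma sqintD F G : sqint F -> sqint G -> sqint (fun g => F g + G g).
Proof.
move=> [mF iF] [mG iG]; split; first exact: cmeasurableD.
have mFn := measurable_funTS (D := @unit_cube R) (measurable_nsqE mF).
have mGn := measurable_funTS (D := @unit_cube R) (measurable_nsqE mG).
have mC := measurable_unit_cube.
have F0 x : (0 <= (nsq (F x))%:E)%E by rewrite lee_fin nsq_ge0.
have G0 x : (0 <= (nsq (G x))%:E)%E by rewrite lee_fin nsq_ge0.
apply: (@le_lt_trans _ _ (\int[@haar R]_(g in @unit_cube R)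
    (2%:E * ((nsq (F g))%:E + (nsq (G g))%:E)))%E).
  apply: ge0_le_integral => //.
  - by move=> g _; rewrite lee_fin nsq_ge0.
  - exact: measurable_funTS (measurable_nsqE (cmeasurableD mF mG)).
  - by apply: emeasurable_funM => //; exact: emeasurable_funD.
  - by move=> g _; rewrite -EFinD -EFinM lee_fin nsqD.
rewrite ge0_integralZl_EFin//; last 2 first.
- by move=> g _; rewrite adde_ge0.
- exact: emeasurable_funD.
by rewrite ge0_integralD// lte_mul_pinfty// lte_add_pinfty.
Qed.

Lemma sqintZ (x : R[i]) F : sqint F -> sqint (fun g => x * F g).
Proof.
move=> [mF iF]; split; first by apply: cmeasurableM => //; exact: cmeasurable_cst.
under eq_integral do rewrite nsqM EFinM.
rewrite ge0_integralZl_EFin ?nsq_ge0//.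
- by rewrite lte_mul_pinfty// lee_fin nsq_ge0.
- exact: measurable_unit_cube.
- by move=> g _; rewrite lee_fin nsq_ge0.
- exact: measurable_funTS (measurable_nsqE mF).
Qed.

Lemma sqint_sum (n : nat) (F : 'I_n -> R * R * R -> R[i]) :
  (forall j, sqint (F j)) -> sqint (fun g => \sum_(j < n) F j g).
Proof.
move=> iF.
elim: (index_enum _) => [|j s IH]; last first.
  by under eq_fun do rewrite big_cons; exact: sqintD.
under eq_fun do rewrite big_nil.
split; first exact: cmeasurable_cst.
rewrite (_ : nsq 0 = 0) ?integral0 ?ltry//.
by rewrite nsqE /= expr0n addr0.
Qed.

Definition cintegrable F :=
  (@haar R).-integrable (@unit_cube R) (fun g => (Re (F g))%:E) /\
  (@haar R).-integrable (@unit_cube R) (fun g => (Im (F g))%:E).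

Lemma integrable_nsq F : sqint F ->
  (@haar R).-integrable (@unit_cube R) (fun g => (nsq (F g))%:E).
Proof.
move=> [mF iF]; apply/integrableP; split.
  exact: measurable_funTS (measurable_nsqE mF).
by under eq_integral do rewrite /= ger0_norm ?nsq_ge0//.
Qed.

(** A product of two square-integrable functions is integrable since
    [|x y| <= |x|^2 + |y|^2]. *)
Lemma cintegrableMJ F G : sqint F -> sqint G ->
  cintegrable (fun g => F g * (G g)^*).
Proof.
move=> sF sG; have [mR mI] := cmeasurableM sF.1 (cmeasurableJ sG.1).
have mC := measurable_unit_cube.
have iFG := integrableD mC (integrable_nsq sF) (integrable_nsq sG).
split; apply: (le_integrable mC _ _ iFG).
- by apply/measurable_EFinP; exact: measurable_funTS.
- move=> g _ /=; rewrite lee_fin [leRHS]ger0_norm ?nsq_ReMJ//.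
  by rewrite addr_ge0 ?nsq_ge0.
- by apply/measurable_EFinP; exact: measurable_funTS.
- move=> g _ /=; rewrite lee_fin [leRHS]ger0_norm ?nsq_ImMJ//.
  by rewrite addr_ge0 ?nsq_ge0.
Qed.

Lemma cintegral_avg (n : nat) (F : 'I_n -> R * R * R -> R[i]) :
  (forall j, cintegrable (F j)) ->
  cintegral (@unit_cube R) (fun g => n%:R^-1 * \sum_(j < n) F j g) =
  n%:R^-1 * \sum_(j < n) cintegral (@unit_cube R) (F j).
Proof.
move=> iF; have mC := measurable_unit_cube.
have L (f : 'I_n -> R * R * R -> R) :
    (forall j, (@haar R).-integrable (@unit_cube R) (EFin \o f j)) ->
    Rintegral (@haar R) (@unit_cube R) (fun g => n%:R^-1 * \sum_(j < n) f j g) =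
    n%:R^-1 * \sum_(j < n) Rintegral (@haar R) (@unit_cube R) (f j).
  move=> fi.
  have S (s : seq 'I_n) :
      (@haar R).-integrable (@unit_cube R) (EFin \o (fun g => \sum_(j <- s) f j g)) /\
      Rintegral (@haar R) (@unit_cube R) (fun g => \sum_(j <- s) f j g) =
      \sum_(j <- s) Rintegral (@haar R) (@unit_cube R) (f j).
    elim: s => [|j s [IH1 IH2]].
      under eq_fun do rewrite big_nil.
      rewrite big_nil; split; first exact: integrable0.
      by rewrite Rintegral_cst// mul0r.
    under eq_fun do rewrite big_cons.
    rewrite big_cons -IH2; split; last by rewrite RintegralD.
    exact: (integrableD mC (fi j) IH1).
  by rewrite RintegralZl ?(S _).2//; exact: (S _).1.
rewrite invnatcE; apply: complexP => /=.
  rewrite -[in RHS]/((n%:R^-1)%:C) ReM/= mul0r subr0 Re_sum -L; last by move=> j; exact: (iF j).1.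
  by congr Rintegral; apply/funext => g; rewrite ReM/= mul0r subr0 Re_sum.
rewrite -[in RHS]/((n%:R^-1)%:C) ImM/= mul0r addr0 Im_sum -L; last by move=> j; exact: (iF j).2.
by congr Rintegral; apply/funext => g; rewrite ImM/= mul0r addr0 Im_sum.
Qed.

End square_integrable.

(** * Lattice invariance and change of variables in complex integrals *)

Section twisted_theory.
Context (R : realType).
Implicit Types (F G : R * R * R -> R[i]).

Lemma twisted_comp (T U : Type) k (f : T -> U) (K : R * R * R -> T) :
  twisted k K -> twisted k (fun g => f (K g)).
Proof. by move=> [K1 K2 K3]; split=> a c z; rewrite (K1, K2, K3). Qed.

Lemma twisted_comp2 (T U V : Type) k (f : T -> U -> V) (K : R * R * R -> T)
    (L : R * R * R -> U) :
  twisted k K -> twisted k L -> twisted k (fun g => f (K g) (L g)).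
Proof.
by move=> [K1 K2 K3] [L1 L2 L3]; split=> a c z;
  rewrite (K1, K2, K3) (L1, L2, L3).
Qed.

Section iterate.
Context (T : Type) (k : nat) (K : R * R * R -> T) (tK : twisted k K).

Lemma twisted_int1 (p : int) a c z : K (a + p%:~R, c, z) = K (a, c, z).
Proof.
by apply: (periodic1_int p a (f := fun a => K (a, c, z))) => x; case: tK.
Qed.

Lemma twisted_int3 (p : int) a c z : K (a, c, z + p%:~R) = K (a, c, z).
Proof.
by apply: (periodic1_int p z (f := fun z => K (a, c, z))) => x; case: tK.
Qed.

Lemma twisted_nat2 (n : nat) a c z :
  K (a, c + n%:R, z) = K (a, c, z - n%:R * (k%:R * a)).
Proof.
elim: n z => [|n IH] z; first by rewrite addr0 mul0r subr0.
case: tK => _ K2 _; rewrite -natr1 addrA K2 IH; congr (K (_, _, _)); ring.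
Qed.

Lemma twisted_int2 (q : int) a c z :
  K (a, c + q%:~R, z) = K (a, c, z - q%:~R * (k%:R * a)).
Proof.
case: q => n; first exact: twisted_nat2.
rewrite NegzE mulrNz -pmulrn -[in RHS](subrK n.+1%:R c) twisted_nat2.
by congr (K (_, _, _)); ring.
Qed.

Lemma twisted_nat1 (n : nat) a c z : K (a + n%:R, c, z) = K (a, c, z).
Proof. exact: (twisted_int1 n). Qed.

End iterate.

Section lattice.
Context (T : Type) (F : R * R * R -> T).

(** Invariance is tested on the three generators [[1, 0, 0]], [[0, 1, 0]] and
    [[0, 0, 1]]. *)
Lemma lattice_invariantP :
  (forall gamma g, heis_lattice gamma -> F (heis_mul gamma g) = F g) <->
  twisted 1 F.
Proof.
split=> [inv|[F1 F2 F3]].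
  have H (p q r : int) a c z :
      F (p%:~R + a, q%:~R + c, r%:~R + z + q%:~R * a) = F (a, c, z).
    by apply: (inv (p%:~R, q%:~R, r%:~R) (a, c, z)); exists p, q, r.
  split=> a c z.
  - by rewrite -(H 1 0 0 a c z) mul0r addr0 !add0r addrC.
  - rewrite -(H 0 1 0 a c) addrC !add0r !mul1r.
    by congr (F (_, _, _)); ring.
  - by rewrite -(H 0 0 1 a c z) mul0r addr0 !add0r addrC.
move=> _ [[a c] z] [p [q [r ->]]] /=.
have -> : (p%:~R + a, q%:~R + c, r%:~R + z + q%:~R * a) =
    (a + p%:~R, c + q%:~R, z + q%:~R * a + r%:~R) :> R * R * R.
  by congr (_, _, _); ring.
have tF : twisted 1 F by [].
by rewrite (twisted_int3 tF) (twisted_int1 tF) (twisted_int2 tF) mul1r addrK.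
Qed.

End lattice.

Lemma inHP F : inH F <-> sqint F /\ twisted 1 F.
Proof.
split=> [[mF /lattice_invariantP iF sF]|[[mF sF] /lattice_invariantP iF]] //.
Qed.

End twisted_theory.

Section transfer.
Context (R : realType) (k n : nat) (phi : 'I_n -> R * R * R -> R * R * R).
Hypothesis mphi : forall j, measurable_fun setT (phi j).

(** Every change of variables below is established for nonnegative functions;
    the hypothesis records such an identity, for a family of maps. *)
Hypothesis phiE : forall K : R * R * R -> \bar R,
  measurable_fun setT K -> (forall g, 0 <= K g)%E -> twisted k K ->
  (\sum_(j < n) cube_int (K \o phi j) = n%:R%:E * cube_int K)%E.

(** Each of the [n] nonnegative terms is bounded by their finite sum. *)
Lemma cube_int_comp_lty (K : R * R * R -> \bar R) j :
  measurable_fun setT K -> (forall g, 0 <= K g)%E -> twisted k K ->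
  (cube_int K < +oo)%E -> (cube_int (K \o phi j) < +oo)%E.
Proof.
move=> mK K0 tK Koo.
have Koo' : (n%:R%:E * cube_int K < +oo)%E by rewrite lte_mul_pinfty// lee_fin.
apply: le_lt_trans Koo'; rewrite -phiE// (bigD1 j)//=.
rewrite leeDl// sume_ge0// => i _.
by do 3 (apply: circle_int_ge0 => ?); exact: K0.
Qed.

Lemma sqint_comp (F : R * R * R -> R[i]) j :
  twisted k F -> sqint F -> sqint (F \o phi j).
Proof.
move=> tF sF; have mF := sF.1.
apply/(sqint_cube_int (cmeasurable_comp mF (mphi j))).
apply: (cube_int_comp_lty (K := fun g => (nsq (F g))%:E)).
- exact: measurable_nsqE.
- by move=> g; rewrite lee_fin nsq_ge0.
- exact: (twisted_comp (fun x => (nsq x)%:E)).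
- exact/(sqint_cube_int mF).
Qed.

(** The integral of a real function is the difference of those of its positive
    and negative parts, which are again twisted; integrability makes all the
    terms finite, so that the identities can be subtracted. *)
Lemma sum_Rintegral_comp (f : R * R * R -> R) :
  twisted k f -> measurable_fun setT f ->
  (@haar R).-integrable (@unit_cube R) (EFin \o f) ->
  (forall j, (@haar R).-integrable (@unit_cube R) (EFin \o (f \o phi j))) /\
  \sum_(j < n) Rintegral (@haar R) (@unit_cube R) (f \o phi j) =
  n%:R * Rintegral (@haar R) (@unit_cube R) f.
Proof.
move=> tf mf intf; have mC := @measurable_unit_cube R.
have mEf : measurable_fun setT (EFin \o f) by apply/measurable_EFinP.
pose P : R * R * R -> \bar R := (EFin \o f)^\+%E; pose N : R * R * R -> \bar R := (EFin \o f)^\-%E.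
have mP : measurable_fun setT P by exact: measurable_funepos.
have mN : measurable_fun setT N by exact: measurable_funeneg.
have P0 g : (0 <= P g)%E by exact: funepos_ge0.
have N0 g : (0 <= N g)%E by exact: funeneg_ge0.
have tP : twisted k P.
  by have [f1 f2 f3] := tf; split=> a c z; rewrite /P !funeposE/= (f1, f2, f3).
have tN : twisted k N.
  by have [f1 f2 f3] := tf; split=> a c z; rewrite /N !funenegE/= (f1, f2, f3).
have Poo : (cube_int P < +oo)%E.
  by rewrite -integral_unit_cube//; exact: integral_funepos_lt_pinfty.
have Noo : (cube_int N < +oo)%E.
  by rewrite -integral_unit_cube//; exact: integral_funeneg_lt_pinfty.
have cu0 K : (forall g, 0 <= K g)%E -> (0 <= @cube_int R K)%E.
  by move=> K0; do 3 (apply: circle_int_ge0 => ?); exact: K0.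
have cufin K : (forall g, 0 <= K g)%E -> (cube_int K < +oo)%E ->
    @cube_int R K \is a fin_num.
  move=> K0 Koo; rewrite ge0_fin_numE; [exact: Koo|exact: cu0].
have Pfin := cufin P P0 Poo; have Nfin := cufin N N0 Noo.
have Pj j : cube_int (P \o phi j) \is a fin_num.
  by apply: cufin => [g|]; [exact: P0|exact: cube_int_comp_lty].
have Nj j : cube_int (N \o phi j) \is a fin_num.
  by apply: cufin => [g|]; [exact: N0|exact: cube_int_comp_lty].
have RE (h : R * R * R -> R) : measurable_fun setT h ->
    (\int[@haar R]_(g in @unit_cube R) (h g)%:E =
     cube_int (EFin \o h)^\+ - cube_int (EFin \o h)^\-)%E.
  move=> mh; have mEh : measurable_fun setT (EFin \o h) by apply/measurable_EFinP.
  rewrite integralE !integral_unit_cube//.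
  + exact: measurable_funeneg.
  + exact: measurable_funepos.
split=> [j|].
  have mfj : measurable_fun setT (f \o phi j) by exact: measurableT_comp.
  apply/integrableP; split; first by apply: measurable_funTS; exact/measurable_EFinP.
  have mA (h : R * R * R -> R) : measurable_fun setT h ->
      measurable_fun setT (fun g => `|(h g)%:E|%E).
    by move=> mh; apply: measurableT_comp => //; apply/measurable_EFinP.
  have A0 (h : R * R * R -> R) g : (0 <= `|(h g)%:E|)%E by exact: abse_ge0.
  apply: (@le_lt_trans _ _ (cube_int ((fun g => `|(f g)%:E|%E) \o phi j))).
    by rewrite -(integral_unit_cube (mA _ mfj) (A0 _)).
  apply: cube_int_comp_lty; [exact: mA|exact: A0|..].
    exact: (twisted_comp (fun x => `|x%:E|%E)).
  by rewrite -(integral_unit_cube (mA _ mf) (A0 _)); have /integrableP[] := intf.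
have -> : Rintegral (@haar R) (@unit_cube R) f =
    fine (cube_int P) - fine (cube_int N).
  exact: (eq_trans (congr1 fine (RE _ mf)) (fineB Pfin Nfin)).
have -> : \sum_(j < n) Rintegral (@haar R) (@unit_cube R) (f \o phi j) =
    \sum_(j < n) fine (cube_int (P \o phi j)) -
    \sum_(j < n) fine (cube_int (N \o phi j)).
  rewrite -sumrB; apply: eq_bigr => j _.
  etransitivity; first exact: (congr1 fine (RE _ (measurableT_comp mf (mphi j)))).
  have -> : ((EFin \o (f \o phi j))^\+)%E = P \o phi j.
    by apply/funext => g; rewrite /P /= !funeposE.
  have -> : ((EFin \o (f \o phi j))^\-)%E = N \o phi j.
    by apply/funext => g; rewrite /N /= !funenegE.
  exact: (fineB (Pj j) (Nj j)).
rewrite mulrBr; congr (_ - _).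
  have := phiE mP P0 tP.
  rewrite -(fineK Pfin) -EFinM => /(congr1 fine) /= <-.
  exact: (sum_fine _ (fun j _ => Pj j)).
have := phiE mN N0 tN.
rewrite -(fineK Nfin) -EFinM => /(congr1 fine) /= <-.
exact: (sum_fine _ (fun j _ => Nj j)).
Qed.

Lemma cintegral_comp (K : R * R * R -> R[i]) :
  twisted k K -> cmeasurable K -> cintegrable K ->
  (forall j, cintegrable (K \o phi j)) /\
  \sum_(j < n) cintegral (@unit_cube R) (K \o phi j) =
  n%:R * cintegral (@unit_cube R) K.
Proof.
move=> tK [mR mI] [iR iI].
have [iRj sR] := sum_Rintegral_comp (twisted_comp (@Re R) tK) mR iR.
have [iIj sI] := sum_Rintegral_comp (twisted_comp (@Im R) tK) mI iI.
split=> [j|]; first by split; [exact: iRj|exact: iIj].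
rewrite (natcE R n); apply: complexP.
  by rewrite Re_sum ReM /= mul0r subr0 -sR.
by rewrite Im_sum ImM /= mul0r addr0 -sI.
Qed.

End transfer.

(** * The Hecke and Fourier operators and their adjoints *)

Section operators.
Context (R : realType).
Implicit Types (F G : R * R * R -> R[i]).

(** The adjoint of [T_m] on all invariant functions; on a function with central
    character [N], the shift by [k a] in [z] becomes the factor [e(k N a)]. *)
Definition hecke_star (m : nat) F : R * R * R -> R[i] :=
  fun g => let: (a, c, z) := g in
    m%:R^-1 * \sum_(k < m) F (m%:R * a, (c + k%:R) / m%:R, z + k%:R * a).

Lemma fourier_comp F : fourier F = F \o @heis_rotation R.
Proof. by apply/funext => -[[a c] z]. Qed.

Lemma fourier3E F g : fourier (fourier (fourier F)) g =
  let: (a, c, z) := g in F (c, - a, z - a * c).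
Proof.
by case: g => [[a c] z] /=; congr (F (_, _, _)); ring.
Qed.

Lemma fourier4 F : fourier (fourier (fourier (fourier F))) = F.
Proof.
apply/funext => -[[a c] z]; rewrite fourier3E /=.
by congr (F (_, _, _)); ring.
Qed.

Lemma hecke_starE (m : nat) F : (0 < m)%N ->
  fourier (fourier (fourier (hecke m (fourier F)))) = hecke_star m F.
Proof.
move=> m0; have mR : m%:R != 0 :> R by rewrite pnatr_eq0 -lt0n.
apply/funext => -[[a c] z]; rewrite fourier3E /=; congr (_ * _).
by apply: eq_bigr => j _; congr (F (_, _, _)); field.
Qed.

Let mp1 := @measurable_proj1 R.
Let mp2 := @measurable_proj2 R.
Let mp3 := @measurable_proj3 R.

Lemma measurable_contract1 m j : measurable_fun setT (@contract1 R m j).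
Proof.
apply: measurable_triple => //.
by apply: measurable_funM => //; exact: measurable_funD.
Qed.

Lemma measurable_contract2 m j : measurable_fun setT (@contract2 R m j).
Proof.
apply: measurable_triple => //.
  by apply: measurable_funM => //; exact: measurable_funD.
by apply: measurable_funD => //; exact: measurable_funM.
Qed.

Lemma measurable_dilate1 m : measurable_fun setT (@dilate1 R m).
Proof. by apply: measurable_triple => //; exact: measurable_funM. Qed.

Lemma measurable_dilate2 m : measurable_fun setT (@dilate2 R m).
Proof. by apply: measurable_triple => //; exact: measurable_funM. Qed.

Lemma measurable_rotation : measurable_fun setT (@heis_rotation R).
Proof. exact: (nonsingular_rotation R).1. Qed.

Lemma twisted_dilate1 m F : twisted 1 F -> twisted m (F \o dilate1 m).
Proof.
move=> tF; split=> a c z; rewrite /dilate1/=.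
- by rewrite mulrDr mulr1 (twisted_nat1 tF).
- by case: tF => _ -> _; rewrite mul1r.
- by case: tF.
Qed.

Lemma twisted_dilate2 m F : twisted 1 F -> twisted m (F \o dilate2 m).
Proof.
move=> tF; split=> a c z; rewrite /dilate2/=.
- by case: tF.
- by rewrite mulrDr mulr1 (twisted_nat2 tF) mul1r.
- by case: tF.
Qed.

Lemma sqint_dilate1 m F : (0 < m)%N -> twisted 1 F -> sqint F ->
  sqint (F \o dilate1 m).
Proof.
move=> m0 tF sF.
apply: (sqint_comp (phi := fun=> @dilate1 R m) (n := 1) (k := 1) _ _ ord0) => //.
  by move=> _; exact: measurable_dilate1.
by move=> K mK K0 tK; rewrite big_ord1 mul1e; exact: (cube_int_dilate1 mK K0 tK m0).
Qed.

Lemma sqint_dilate2 m F : (0 < m)%N -> twisted 1 F -> sqint F ->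
  sqint (F \o dilate2 m).
Proof.
move=> m0 tF sF.
apply: (sqint_comp (phi := fun=> @dilate2 R m) (n := 1) (k := 1) _ _ ord0) => //.
  by move=> _; exact: measurable_dilate2.
by move=> K mK K0 tK; rewrite big_ord1 mul1e; exact: (cube_int_dilate2 mK K0 tK m0).
Qed.

Lemma inH_fourier F : inH F -> inH (fourier F).
Proof.
move=> /inHP[sF tF]; apply/inHP; split.
  rewrite fourier_comp.
  apply: (sqint_comp (phi := fun=> @heis_rotation R) (n := 1) (k := 1) _ _ ord0) => //.
    by move=> _; exact: measurable_rotation.
  by move=> K mK K0 tK; rewrite big_ord1 mul1e; exact: (cube_int_rotation mK K0 tK).
have tF2 := twisted_int1 tF (-1); have [F1 F2 F3] := tF.
split=> a c z /=.
- by rewrite F2; congr (F (_, _, _)); ring.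
- by rewrite opprD tF2; congr (F (_, _, _)); ring.
- by rewrite -addrA (addrC 1) addrA F3.
Qed.

Lemma sum_ord_shift (V : zmodType) (n : nat) (f : nat -> V) : f n = f 0%N ->
  \sum_(j < n) f j.+1 = \sum_(j < n) f j.
Proof.
move=> fn; apply: (addIr (f 0%N)).
rewrite addrC -[LHS](big_ord_recl n (fun j => f j)) big_ord_recr/=.
by rewrite fn.
Qed.

(** The shift [a -> a + 1] permutes the terms cyclically; the shift
    [c -> c + 1] moves the second argument by [m], hence, by invariance, the
    third one by [- (a + j)]. *)
Lemma inH_hecke m F : (0 < m)%N -> inH F -> inH (hecke m F).
Proof.
move=> m0 /inHP[sF tF]; have mR : m%:R != 0 :> R by rewrite pnatr_eq0 -lt0n.
apply/inHP; split.
  have -> : hecke m F =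
      fun g => m%:R^-1 * \sum_(j < m) ((F \o dilate2 m) \o contract1 j) g.
    by apply/funext => -[[a c] z].
  apply: sqintZ; apply: sqint_sum => j.
  apply: (sqint_comp (k := m) (phi := @contract1 R m)).
  - exact: measurable_contract1.
  - by move=> K mK K0 tK; exact: (cube_int_sum_contract1 mK K0 m0).
  - exact: twisted_dilate2.
  - exact: sqint_dilate2.
split=> a c z /=; congr (_ * _).
- pose f j := F ((a + j%:R) / m%:R, m%:R * c, z).
  rewrite -[RHS](@sum_ord_shift _ _ f); last first.
    by rewrite /f addr0 mulrDl divff// (twisted_nat1 tF 1).
  by apply: eq_bigr => j _; rewrite /f -natr1 addrAC addrA.
- apply: eq_bigr => j _; rewrite mulrDr mulr1 (twisted_nat2 tF).
  rewrite -[RHS](twisted_int3 tF (- j%:Z)); congr (F (_, _, _)).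
  by rewrite mulrNz -pmulrn; field.
- by apply: eq_bigr => j _; case: tF.
Qed.

Lemma inH_hecke_star m F : (0 < m)%N -> inH F -> inH (hecke_star m F).
Proof.
move=> m0 iF; rewrite -hecke_starE//.
by do 3 apply: inH_fourier; apply: inH_hecke => //; exact: inH_fourier.
Qed.

(** The two library conjugations, of a closed field and of the pairs [R[i]],
    are convertible; the second one has explicit components. *)
Lemma innerE F G :
  inner F G = cintegral (@unit_cube R) (fun g => F g * conjc (G g)).
Proof. by []. Qed.

(** The integrand of [<R F, G>] is [(F conj (R^3 G)) o rho], where [rho] is the
    substitution defining [R], because [R^4 = 1]; and [rho] preserves integrals
    of invariant functions. *)
Lemma is_adjoint_fourier :
  is_adjoint (@fourier R) (fun F => fourier (fourier (fourier F))).
Proof.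
split=> [F iF|F G iF iG]; first by do 3 apply: inH_fourier.
pose G3 := fourier (fourier (fourier G)).
have /inHP[sG3 tG3] : inH G3 by do 3 apply: inH_fourier.
have /inHP[sF tF] := iF.
pose K g := F g * (G3 g)^*.
have tK : twisted 1 K by exact: (twisted_comp2 (fun x y => x * y^*)).
have mK : cmeasurable K.
  by apply: cmeasurableM; [exact: sF.1|apply: cmeasurableJ; exact: sG3.1].
have := cintegral_comp (phi := fun=> @heis_rotation R) (n := 1) _ _ tK mK
  (cintegrableMJ sF sG3).
case=> [_|L mL L0 tL|_].
- exact: measurable_rotation.
- by rewrite big_ord1 mul1e; exact: (cube_int_rotation mL L0 tL).
rewrite big_ord1 mul1r => KE; rewrite !innerE -[RHS]KE; congr cintegral.
apply/funext => g.
have fE H : fourier H g = H (heis_rotation g) by rewrite fourier_comp.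
have GE : G g = G3 (heis_rotation g) by rewrite -fE /G3 fourier4.
by rewrite fE GE.
Qed.

(** Both inner products are averages of the pull-backs of the same function
    [K], along two families of contractions that preserve its integral. *)
Lemma is_adjoint_hecke m : (0 < m)%N ->
  is_adjoint (@hecke R m) (hecke_star m).
Proof.
move=> m0; have mR : m%:R != 0 :> R by rewrite pnatr_eq0 -lt0n.
split=> [F|F G /inHP[sF tF] /inHP[sG tG]]; first exact: inH_hecke_star.
pose K g := (F \o dilate2 m) g * ((G \o dilate1 m) g)^*.
have tK : twisted m K.
  by apply: (twisted_comp2 (fun x y => x * y^*));
    [exact: twisted_dilate2|exact: twisted_dilate1].
have sF2 := sqint_dilate2 m0 tF sF; have sG1 := sqint_dilate1 m0 tG sG.
have mK : cmeasurable K.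
  by apply: cmeasurableM; [exact: sF2.1|apply: cmeasurableJ; exact: sG1.1].
have iK : cintegrable K := cintegrableMJ sF2 sG1.
have [L mL L0 tL|iK1 sK1] := cintegral_comp (@measurable_contract1 m) _ tK mK iK.
  exact: (cube_int_sum_contract1 mL L0 m0).
have [L mL L0 tL|iK2 sK2] := cintegral_comp (@measurable_contract2 m) _ tK mK iK.
  exact: (cube_int_sum_contract2 mL L0 tL m0).
rewrite !innerE.
transitivity (cintegral (@unit_cube R)
    (fun g => m%:R^-1 * \sum_(j < m) (K \o contract1 j) g)).
  congr cintegral; apply/funext => -[[a c] z] /=.
  rewrite -mulrA mulr_suml; congr (_ * _); apply: eq_bigr => j _.
  rewrite /K /dilate1 /dilate2 /contract1/=; congr (_ * (_ )^*).
  by rewrite mulrC divfK// (twisted_nat1 tG).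
rewrite (cintegral_avg iK1) sK1 -sK2 -(cintegral_avg iK2).
congr cintegral; apply/funext => -[[a c] z] /=.

rewrite conj_invnatM mulrCA; congr (_ * _).
rewrite conj_sum mulr_sumr; apply: eq_bigr => j _.
rewrite /K /dilate1 /dilate2 /contract2/=; congr (_ * _).
by rewrite mulrC divfK// (twisted_nat2 tF) mul1r addrK.
Qed.

End operators.

(** * Almost-everywhere equality and uniqueness of adjoints *)

Lemma ae_forall_countable d (T : measurableType d) (R : realType)
    (mu : {measure set T -> \bar R}) (I : countType) (P : I -> T -> Prop) :
  (forall i, {ae mu, forall x, P i x}) -> {ae mu, forall x, forall i, P i x}.
Proof.
move=> aeP.
have : {ae mu, forall x, forall n, if unpickle n is Some i then P i x else True}.
  apply: ae_foralln => n; case: (unpickle n) => [i|]; first exact: aeP.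
  exact: aeW.
by apply: filterS => x /= H i; have := H (pickle i); rewrite pickleK.
Qed.

(** Monotonicity of almost-everywhere statements, with the filter of the
    product measure [haar] given explicitly. *)
Lemma haar_aeS (R : realType) (P Q : R * R * R -> Prop) :
  (forall g, P g -> Q g) -> {ae @haar R, forall g, P g} ->
  {ae @haar R, forall g, Q g}.
Proof.
by move=> PQ; apply: (@filterS _ _ (ae_filter_ringOfSetsType (@haar R))).
Qed.

Section ae_lattice.
Context (R : realType).
Implicit Types (F G : R * R * R -> R[i]) (g : R * R * R).

Lemma nonsingular_lattice (p q r : int) :
  nonsingular (@haar R) (heis_mul (p%:~R, q%:~R, r%:~R)).
Proof.
have -> : heis_mul (p%:~R, q%:~R, r%:~R) =
    skew 1 p%:~R 1 q%:~R (fun x : R * R => r%:~R + q%:~R * x.1).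
  by apply/funext => -[[a c] z]; rewrite /skew/=; congr (_, _, _); ring.
apply: nonsingular_haar_skew; rewrite ?oner_neq0//.
by apply: measurable_funD => //; exact: measurable_funM.
Qed.

Lemma frac_itv (x : R) : 0 <= x - (Num.floor x)%:~R < 1.
Proof.
by rewrite subr_ge0 ge_floor ltrBlDr addrC -intrD1 floorD1_gt.
Qed.

(** Countably many lattice translates of the cube cover the group, and a
    lattice translation is nonsingular. *)
Lemma ae_of_cube (P : R * R * R -> Prop) :
  (forall gamma g, heis_lattice gamma -> P (heis_mul gamma g) -> P g) ->
  {ae @haar R, forall g, unit_cube g -> P g} -> {ae @haar R, forall g, P g}.
Proof.
move=> Pinv Pcube.
have : {ae @haar R, forall g, forall t : int * int * int,
    unit_cube (heis_mul (t.1.1%:~R, t.1.2%:~R, t.2%:~R) g) ->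
    P (heis_mul (t.1.1%:~R, t.1.2%:~R, t.2%:~R) g)}.
  apply: ae_forall_countable => t.
  exact: (nonsingular_ae (nonsingular_lattice t.1.1 t.1.2 t.2) Pcube).
apply: haar_aeS => -[[a c] z] /= H.
(* The translation by [q] in [c] shears [z], so [r] depends on [q]. *)
pose q := - Num.floor c; pose r := - Num.floor (z + q%:~R * a).
have := H (- Num.floor a, q, r); rewrite /= => {}H.
apply: (Pinv ((- Num.floor a)%:~R, q%:~R, r%:~R)).
  by exists (- Num.floor a), q, r.
have [a0 a1] := andP (frac_itv a); have [c0 c1] := andP (frac_itv c).
have [z0 z1] := andP (frac_itv (z + q%:~R * a)).
apply: H; split; [split|] => /=; rewrite in_itv/=.
- by rewrite mulrNz addrC a0 ltW.
- by rewrite mulrNz addrC c0 ltW.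
- by rewrite -addrA mulrNz addrC z0 ltW.
Qed.

(** With [D = S1 F - S2 F], both [<D, S1 F>] and [<D, S2 F>] equal [<T D, F>],
    so [<D, D> = 0]. *)
Lemma adjoint_unique T S1 S2 F : is_adjoint T S1 -> is_adjoint T S2 ->
  inH F -> S1 F =ae S2 F.
Proof.
move=> [iS1 aS1] [iS2 aS2] iF.
have /inHP[s1 t1] := iS1 _ iF; have /inHP[s2 t2] := iS2 _ iF.
pose D g := S1 F g + (-1) * S2 F g.
have sD : sqint D by apply: sqintD => //; exact: sqintZ.
have tD : twisted 1 D by exact: (twisted_comp2 (fun x y => x + (-1) * y)).
have iD : inH D by exact/inHP.
have mC := @measurable_unit_cube R.
have DE : inner D (S1 F) = inner D (S2 F) by rewrite -aS1// aS2.
have i1 := (cintegrableMJ sD s1).1; have i2 := (cintegrableMJ sD s2).1.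
have D0 : Rintegral (@haar R) (@unit_cube R) (fun g => nsq (D g)) = 0.
  have := congr1 (@Re R) DE; rewrite !innerE => /eqP; rewrite -subr_eq0 => /eqP <-.
  rewrite -[RHS](RintegralB mC i1 i2); congr Rintegral.
  apply/funext => g; rewrite nsqE !ReM !ReJ !ImJ.
  by rewrite /D !ReD !ImD !ReM !ImM /=; ring.
have intD0 : (\int[@haar R]_(g in @unit_cube R) (nsq (D g))%:E = 0)%E.
  rewrite -(@fineK _ (\int[_]_(_ in _) _)%E); first exact: (congr1 EFin D0).
  rewrite ge0_fin_numE; first exact: sD.2.
  by apply: integral_ge0 => g _; rewrite lee_fin nsq_ge0.
have mD := measurable_funTS (D := @unit_cube R) (measurable_nsqE sD.1).
have aeD : {ae @haar R, forall g, unit_cube g -> S1 F g = S2 F g}.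
  have [H _] := ae_eq_integral_abs (@haar R) mC mD.
  have := H _; rewrite (_ : (\int[_]_(_ in _) `|_|)%E = 0%E); last first.
    rewrite -[RHS]intD0; apply: eq_integral => g _.
    by rewrite gee0_abs// lee_fin nsq_ge0.
  move=> /(_ erefl); apply: haar_aeS => g /= Hg Cg.
  have [/nsq_eq0] := Hg Cg.
  by rewrite /D mulN1r => /eqP; rewrite subr_eq0 => /eqP.
have := @ae_of_cube (fun g => S1 F g = S2 F g) _ aeD.
move=> H; have {H} : {ae @haar R, forall g, S1 F g = S2 F g}.
  apply: H => gamma g Lg.
  have /(iffRL (@lattice_invariantP _ _ (S1 F))) -> // := t1.
  by have /(iffRL (@lattice_invariantP _ _ (S2 F))) -> := t2.
by apply: haar_aeS => g.
Qed.

Lemma is_adjoint_adjoint T S : is_adjoint T S -> is_adjoint T (@adjoint R T).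
Proof. by move=> TS; exact: (@xgetPex _ _ [set S | is_adjoint T S] (ex_intro _ S TS)). Qed.

Lemma adjoint_ae T S F : is_adjoint T S -> inH F -> adjoint T F =ae S F.
Proof.
by move=> TS; exact: (adjoint_unique (is_adjoint_adjoint TS) TS).
Qed.

Lemma ae_comp n (phi : 'I_n -> R * R * R -> R * R * R) F G :
  (forall j, nonsingular (@haar R) (phi j)) -> F =ae G ->
  {ae @haar R, forall g, forall j, F (phi j g) = G (phi j g)}.
Proof.
move=> nphi FG; apply: ae_forall_countable => j.
have FG' : {ae @haar R, forall g, F g = G g} by apply: haar_aeS FG => g; apply.
exact: (nonsingular_ae (nphi j) FG').
Qed.

Lemma ae_hecke m F G : (0 < m)%N -> F =ae G -> hecke m F =ae hecke m G.
Proof.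
move=> m0 FG; have mR : m%:R != 0 :> R by rewrite pnatr_eq0 -lt0n.
pose phi (j : 'I_m) := skew m%:R^-1 (j%:R / m%:R) m%:R 0 (fun _ : R * R => 0).
have nphi j : nonsingular (@haar R) (phi j).
  by apply: nonsingular_haar_skew => //; rewrite invr_eq0.
apply: haar_aeS (ae_comp nphi FG) => -[[a c] z] /= H _; congr (_ * _).
apply: eq_bigr => j _; have := H j; rewrite /phi /skew/= !addr0.
by rewrite (mulrC _ a) -mulrDl.
Qed.

Lemma ae_fourier F G : F =ae G -> fourier F =ae fourier G.
Proof.
move=> FG; rewrite !fourier_comp.
have FG' : {ae @haar R, forall g, F g = G g} by apply: haar_aeS FG => g; apply.
by apply: haar_aeS (nonsingular_ae (nonsingular_rotation R) FG').
Qed.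

(** Through [S = R^3 T_m R] this follows from the two operators it is made
    of. *)
Lemma ae_hecke_star m F G : (0 < m)%N -> F =ae G ->
  hecke_star m F =ae hecke_star m G.
Proof.
move=> m0 FG; rewrite -!hecke_starE//.
by do 3 apply: ae_fourier; apply: ae_hecke => //; exact: ae_fourier.
Qed.

End ae_lattice.

(** * Additive characters and divisibility *)

Section exponential.
Context (R : realType).
Implicit Types (s t : R).

Lemma expi2piD s t : expi2pi (s + t) = expi2pi s * expi2pi t.
Proof.
by apply: complexP; rewrite /expi2pi ?ReM ?ImM /= mulrDr ?cosD ?sinD; ring.
Qed.

Lemma expi2pi0 : expi2pi (0 : R) = 1.
Proof. by rewrite /expi2pi mulr0 cos0 sin0. Qed.

Lemma expi2pi1 : expi2pi (1 : R) = 1.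
Proof.
have -> : (1 : R) = 2^-1 + 2^-1 by field.
rewrite expi2piD /expi2pi mulrAC divff ?pnatr_eq0// mul1r cospi sinpi.
by apply: complexP; rewrite (ReM, ImM)/=; ring.
Qed.

Lemma expi2pi_periodic : periodic1 (@expi2pi R).
Proof. by move=> t; rewrite expi2piD expi2pi1 mulr1. Qed.

Lemma expi2pi_int (n : int) : expi2pi (n%:~R : R) = 1.
Proof. by rewrite -[n%:~R]add0r (periodic1_int _ _ expi2pi_periodic) expi2pi0. Qed.

Lemma expi2piMn t (n : nat) : expi2pi (n%:R * t) = expi2pi t ^+ n.
Proof.
elim: n => [|n IH]; first by rewrite mul0r expi2pi0.
by rewrite -natr1 mulrDl mul1r expi2piD IH exprSr.
Qed.

Lemma nsq_expi2pi t : nsq (expi2pi t) = 1.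
Proof. by rewrite nsqE /= cos2Dsin2. Qed.

(** For [0 < t < 1] the value [sin (pi t)] is positive, and
    [cos (2 pi t) = 1 - 2 (sin (pi t))^2]. *)
Lemma expi2pi_eq1 t : 0 <= t < 1 -> expi2pi t = 1 -> t = 0.
Proof.
move=> /andP[t0 t1] E; apply/eqP/negPn/negP => tn0.
have tp : 0 < t by rewrite lt_def tn0.
have : 0 < sin (pi * t).
  apply: sin_gt0_pi; rewrite mulr_gt0 ?pi_gt0//=.
  by rewrite -[ltRHS]mulr1 ltr_pM2l ?pi_gt0.
have := congr1 (@Re R) E; rewrite /= (_ : 2 * pi * t = pi * t + pi * t); last by ring.
by rewrite cosD; have := cos2Dsin2 (pi * t); nra.
Qed.

(** Orthogonality of the characters of [Z/m]: a geometric sum whose ratio [w]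
    satisfies [w ^ m = 1], and [w = 1] exactly when [m] divides [n]. *)
Lemma sum_roots_of_unity (m : nat) (n : int) : (0 < m)%N ->
  \sum_(j < m) expi2pi (n%:~R * j%:R / m%:R : R) =
  if (m%:Z %| n)%Z then m%:R else 0.
Proof.
move=> m0; have mR : m%:R != 0 :> R by rewrite pnatr_eq0 -lt0n.
pose w := expi2pi (n%:~R / m%:R : R).
have wE (j : nat) : expi2pi (n%:~R * j%:R / m%:R : R) = w ^+ j.
  by rewrite -expi2piMn; congr expi2pi; ring.
under eq_bigr do rewrite wE.
case: ifPn => [/dvdzP[q nE]|ndvd].
  have -> : w = 1.
    by rewrite /w nE intrM -mulrA -pmulrn divff// mulr1 expi2pi_int.
  by under eq_bigr do rewrite expr1n; rewrite sumr_const card_ord.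
apply/eqP; have /eqP := subrX1 w m.
have -> : w ^+ m = 1.
  by rewrite -wE mulfK// expi2pi_int.
rewrite subrr eq_sym mulf_eq0 => /orP[|//]; rewrite subr_eq0 => /eqP w1.
case/negP: ndvd; have mz : m%:Z != 0 by rewrite eqz_nat -lt0n.
have r0 := modz_ge0 n mz; have r1 := ltz_pmod n (m0 : 0 < m%:Z).
have : (n %% m)%Z%:~R / m%:R = 0 :> R.
  apply: expi2pi_eq1.
    rewrite divr_ge0 ?ler0z//= ltr_pdivrMr ?ltr0n// mul1r.
    by rewrite -[m%:R]/(m%:Z%:~R) ltr_int.
  have nE : n%:~R = (n %/ m)%Z%:~R * m%:R + (n %% m)%Z%:~R :> R.
    by rewrite {1}(divz_eq n m) intrD intrM.
  by rewrite -w1 /w nE mulrDl mulfK// addrC (periodic1_int _ _ expi2pi_periodic).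
move=> /eqP; rewrite mulf_eq0 invr_eq0 (negPf mR) orbF intr_eq0 => /eqP.
by move/dvdz_mod0P.
Qed.

Lemma sum_dvdn (V : nmodType) (d q : nat) (f : nat -> V) : (0 < q)%N ->
  \sum_(j < d * q | (q %| j)%N) f j = \sum_(l < d) f (l * q)%N.
Proof.
move=> q0; elim: d => [|d IH]; first by rewrite !big_ord0.
rewrite big_ord_recr/= -IH -!(big_mkord (fun j => q %| j)%N f).
rewrite mulSn addnC (big_cat_nat _ (n := d * q))//=; last exact: leq_addr.
congr (_ + _); rewrite -{1}[(d * q)%N]add0n big_addn addKn.
rewrite big_mkord; under eq_bigl => i do rewrite dvdn_addl ?dvdn_mull//.
case: q q0 {IH} => // q _.
rewrite (bigD1 ord0)//= add0n big1 ?addr0// => i /andP[/dvdnP[k iE] i0].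
move: i0; rewrite -val_eqE/=; case: k iE => [->//|k iE _].
by have := ltn_ord i; rewrite iE mulSn ltnNge leq_addr.
Qed.

(** With [d] the gcd, [|N| / d] is coprime to [m / d]. *)
Lemma dvdz_mul_gcdn (m : nat) (N : int) (j : nat) : (0 < m)%N ->
  (m%:Z %| N * j%:Z)%Z = (m %/ gcdn m `|N| %| j)%N.
Proof.
move=> m0; rewrite dvdzE abszM !absz_nat; set d := gcdn m _.
have d0 : (0 < d)%N by rewrite gcdn_gt0 m0.
have mE : (m %/ d * d = m)%N by rewrite divnK ?dvdn_gcdl.
have NE : (`|N| %/ d * d = `|N|)%N by rewrite divnK ?dvdn_gcdr.
have cop : coprime (m %/ d) (`|N| %/ d).
  by rewrite /coprime -(eqn_pmul2r d0) mul1n muln_gcdl mE NE.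
by rewrite -{1}mE -{1}NE mulnAC dvdn_pmul2r// Gauss_dvdr.
Qed.

End exponential.

(** * Representatives with an exact central character *)

Section central_character.
Context (R : realType).
Implicit Types (F G : R * R * R -> R[i]) (g : R * R * R) (N : int).

(** The defining property of [H_N], at every point instead of almost every
    one. *)
Definition central (N : int) F :=
  forall a c z t, F (a, c, z + t) = expi2pi (N%:~R * t) * F (a, c, z).

Lemma central_inHN N F : inH F -> central N F -> inHN N F.
Proof.
move=> iF cF; split=> //; exists F; split=> //; first exact: aeW.
by apply: aeW => -[[a c] z] _; rewrite -cF add0r.
Qed.

(** Coordinates of [[p, q, 0]^-1 g] with [p = floor a] and [q = floor c], the
    translate of [g] whose first two coordinates lie in the unit square. *)
Definition fold_a g : R := g.1.1 - (Num.floor g.1.1)%:~R.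
Definition fold_c g : R := g.1.2 - (Num.floor g.1.2)%:~R.
Definition fold_z g : R := g.2 - (Num.floor g.1.2)%:~R * fold_a g.

(** The function with central character [N] whose values at [(a, c, 0)], for
    [(a, c)] in the unit square, are [f a c], extended by lattice
    invariance. *)
Definition quasi_extend (N : int) (f : R -> R -> R[i]) g : R[i] :=
  expi2pi (N%:~R * fold_z g) * f (fold_a g) (fold_c g).

Lemma twisted_quasi_extend N f : twisted 1 (quasi_extend N f).
Proof.
have E (n : int) (t : R) : expi2pi (N%:~R * (t + n%:~R)) = expi2pi (N%:~R * t).
  by rewrite mulrDr -intrM expi2piD expi2pi_int mulr1.
have F1 (x : R) : (Num.floor (x + 1))%:~R = (Num.floor x)%:~R + 1 :> R.
  by rewrite floorDrz ?floor1 ?intrD1// ?rpred1.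
split=> a c z; rewrite /quasi_extend /fold_z /fold_a /fold_c/= ?F1.
- have -> : a + 1 - ((Num.floor a)%:~R + 1) = a - (Num.floor a)%:~R by ring.
  by [].
- have -> : c + 1 - ((Num.floor c)%:~R + 1) = c - (Num.floor c)%:~R by ring.
  by congr (_ * _); rewrite -[RHS](E (Num.floor a)); congr expi2pi; ring.
- by congr (_ * _); rewrite -[RHS](E 1); congr expi2pi; ring.
Qed.

Lemma central_quasi_extend N f : central N (quasi_extend N f).
Proof.
move=> a c z t; rewrite /quasi_extend mulrA -expi2piD; congr (expi2pi _ * _).
by rewrite /fold_z /fold_a/=; ring.
Qed.

Lemma measurable_floor :
  measurable_fun setT (fun x : R => (Num.floor x)%:~R : R).
Proof.
apply: nondecreasing_measurable => // x y xy.
by rewrite ler_int le_floor.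
Qed.

Lemma measurable_fold_a : measurable_fun setT fold_a.
Proof.
apply: measurable_funB; first exact: measurable_proj1.
exact: (measurableT_comp measurable_floor (@measurable_proj1 R)).
Qed.

Lemma measurable_fold_c : measurable_fun setT fold_c.
Proof.
apply: measurable_funB; first exact: measurable_proj2.
exact: (measurableT_comp measurable_floor (@measurable_proj2 R)).
Qed.

Lemma measurable_fold_z : measurable_fun setT fold_z.
Proof.
apply: measurable_funB; first exact: measurable_proj3.
apply: measurable_funM; last exact: measurable_fold_a.
exact: (measurableT_comp measurable_floor (@measurable_proj2 R)).
Qed.

Lemma cmeasurable_quasi_extend N F : cmeasurable F ->
  cmeasurable (quasi_extend N (fun a c => F (a, c, 0))).
Proof.
move=> mF; apply: cmeasurableM.
  by apply: cmeasurable_expi; apply: measurable_funM => //; exact: measurable_fold_z.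
apply: (@cmeasurable_comp _ F (fun g => (fold_a g, fold_c g, 0))) => //.
apply: measurable_triple => //; [exact: measurable_fold_a|exact: measurable_fold_c].
Qed.

(** The restriction [F0 (a, c, 0)] of the given representative is
    quasi-periodic only almost everywhere, so the new representative uses its
    values on the unit square and extends them.  It agrees with [F0] wherever
    the central-character identity holds at all lattice translates of the point,
    which is almost everywhere because the lattice is countable. *)
Lemma inHN_central N F : inHN N F ->
  exists F1, [/\ inH F1, F =ae F1 & central N F1].
Proof.
move=> [iF [F0 [iF0 FF0 F0E]]].
have /inHP[sF0 tF0] := iF0.
pose F1 := quasi_extend N (fun a c => F0 (a, c, 0)); exists F1.
have F0E' : {ae @haar R, forall g, F0 g = expi2pi (N%:~R * g.2) * F0 (g.1.1, g.1.2, 0)}.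
  by apply: haar_aeS F0E => -[[a c] z]; exact.
have F01 : {ae @haar R, forall g, F0 g = F1 g}.
  have : {ae @haar R, forall g, forall t : int * int,
      let h := heis_mul (t.1%:~R, t.2%:~R, (0 : int)%:~R) g in
      F0 h = expi2pi (N%:~R * h.2) * F0 (h.1.1, h.1.2, 0)}.
    apply: ae_forall_countable => t.
    exact: (nonsingular_ae (nonsingular_lattice R t.1 t.2 0) F0E').
  apply: haar_aeS => -[[a c] z] H.
  have := H (- Num.floor a, - Num.floor c); rewrite /=.
  have L : heis_lattice ((- Num.floor a)%:~R, (- Num.floor c)%:~R, (0 : int)%:~R : R).
    by exists (- Num.floor a), (- Num.floor c), 0.
  have := iffRL (@lattice_invariantP _ _ F0) tF0 _ (a, c, z) L.
  rewrite /= => -> ->.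
  rewrite /F1 /quasi_extend /fold_z /fold_c /fold_a/= !mulrNz ![- _ + _]addrC.
  congr (_ * _).
  (* The exponents differ by an integer multiple of [N]. *)
  rewrite -[RHS]mul1r -(expi2pi_int R (- (N * Num.floor c * Num.floor a))) -expi2piD.
  by congr expi2pi; rewrite mulrNz !intrM; ring.
have mF1 : cmeasurable F1 by exact: cmeasurable_quasi_extend sF0.1.
split; last exact: central_quasi_extend.
  apply/inHP; split; last exact: twisted_quasi_extend.
  split=> //; rewrite -(@ge0_ae_eq_integral _ _ _ (@haar R) (@unit_cube R)
    (fun g => (nsq (F0 g))%:E)); [exact: sF0.2|..].
  - exact: measurable_unit_cube.
  - exact: measurable_funTS (measurable_nsqE sF0.1).
  - exact: measurable_funTS (measurable_nsqE mF1).
  - by move=> g _; rewrite lee_fin nsq_ge0.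
  - by move=> g _; rewrite lee_fin nsq_ge0.
  - by apply: haar_aeS F01 => g -> _.
apply: (ae_eq_trans FF0); apply: haar_aeS F01 => g -> _ //.
Qed.

End central_character.

Section pointwise.
Context (R : realType) (m : nat) (N : int).
Hypothesis m0 : (0 < m)%N.
Variable F : R * R * R -> R[i].
Hypotheses (tF : twisted 1 F) (cF : central N F).

Let mR : m%:R != 0 :> R. Proof. by rewrite pnatr_eq0 -lt0n. Qed.
Let mC : m%:R != 0 :> R[i]. Proof. by rewrite pnatr_eq0 -lt0n. Qed.
Let d := gcdn m `|N|%N.
Let d0 : (0 < d)%N. Proof. by rewrite gcdn_gt0 m0. Qed.
Let q := (m %/ d)%N.
Let mE : (m = d * q)%N. Proof. by rewrite mulnC divnK ?dvdn_gcdl. Qed.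
Let q0 : (0 < q)%N.
Proof. by move: m0; rewrite mE muln_gt0 => /andP[]. Qed.
Let qR : q%:R != 0 :> R. Proof. by rewrite pnatr_eq0 -lt0n. Qed.
Let dR : d%:R != 0 :> R. Proof. by rewrite pnatr_eq0 -lt0n. Qed.

Lemma hecke_star_central g : hecke_star m F g =
  let: (a, c, z) := g in m%:R^-1 * \sum_(k < m)
    expi2pi (k%:R * N%:~R * a) * F (m%:R * a, (c + k%:R) / m%:R, z).
Proof.
case: g => [[a c] z] /=; congr (_ * _); apply: eq_bigr => k _.
by rewrite cF; congr (expi2pi _ * _); ring.
Qed.

Lemma central_hecke_star : central N (hecke_star m F).
Proof.
move=> a c z t /=; rewrite mulrCA; congr (_ * _); rewrite mulr_sumr.
by apply: eq_bigr => k _; rewrite addrAC cF.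
Qed.

(** The character sum is [m] when [m] divides [e j] and [0] otherwise, so only
    the multiples of [q = m / d] survive.  The two compositions produce
    the characters with [e = N] and [e = - N]. *)
Lemma average_character (e : int) (f : nat -> R[i]) : `|e|%N = `|N|%N ->
  m%:R^-1 * (m%:R^-1 * \sum_(j < m) (\sum_(k < m)
     expi2pi (e%:~R * j%:R * k%:R / m%:R : R)) * f j) =
  m%:R^-1 * \sum_(l < d) f (l * q)%N.
Proof.
move=> eN; congr (_ * _).
have -> : \sum_(l < d) f (l * q)%N = \sum_(j < m | (q %| j)%N) f j.
  by rewrite [in RHS]mE sum_dvdn.
rewrite [RHS]big_mkcond mulr_sumr; apply: eq_bigr => j _.
have -> : \sum_(k < m) expi2pi (e%:~R * j%:R * k%:R / m%:R : R) =
    if (q %| j)%N then m%:R else 0.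
  rewrite /q /d -eN -dvdz_mul_gcdn// -(sum_roots_of_unity R (e * j%:Z) m0).
  by apply: eq_bigr => k _; rewrite intrM.
by case: ifP => _; [rewrite mulrA mulVf ?mul1r|rewrite mul0r mulr0].
Qed.

Lemma lq_div (l : nat) : (l * q)%:R / m%:R = l%:R / d%:R :> R.
Proof. by rewrite [in LHS]mE !natrM; field; rewrite qR dR. Qed.

(** In the double sum the argument [c + k] is brought back to [c] at the cost
    of [- k (a + j/m)] in [z], which leaves the character [e(- N j k / m)]. *)
Lemma hecke_star_hecke g : hecke_star m (hecke m F) g =
  let: (a, c, z) := g in m%:R^-1 * \sum_(l < d) F (a + l%:R / d%:R, c, z).
Proof.
case: g => [[a c] z].
rewrite -[RHS]/(m%:R^-1 * \sum_(l < d) F (a + l%:R / d%:R, c, z)).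
under [in RHS]eq_bigr => l _ do rewrite -lq_div.
rewrite -(@average_character (- N) (fun j => F (a + j%:R / m%:R, c, z))); last first.
  by rewrite abszN.
rewrite /= -mulr_sumr; congr (_ * (_ * _)).
under [RHS]eq_bigr do rewrite mulr_suml.
rewrite [RHS]exchange_big/=; apply: eq_bigr => k _; apply: eq_bigr => j _.
have -> : F ((m%:R * a + j%:R) / m%:R, m%:R * ((c + k%:R) / m%:R), z + k%:R * a) =
    F (a + j%:R / m%:R, c + k%:R, z + k%:R * a).
  by congr (F (_, _, _)); field.
rewrite (twisted_nat2 tF) mul1r -addrA cF.
by congr (expi2pi _ * _); rewrite mulrNz; ring.
Qed.

(** The argument [a + j] is brought back to [a] for free, and the shift
    [k (a + j) / m] in [z] contributes [e(N k a / m) e(N k j / m)]. *)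
Lemma hecke_hecke_star g : hecke m (hecke_star m F) g =
  let: (a, c, z) := g in m%:R^-1 * \sum_(l < d)
    expi2pi (N%:~R * l%:R / d%:R * a) * F (a, c + l%:R / d%:R, z).
Proof.
case: g => [[a c] z].
pose f (k : nat) := expi2pi (N%:~R * (k%:R / m%:R * a)) * F (a, c + k%:R / m%:R, z).
transitivity (m%:R^-1 * \sum_(l < d) f (l * q)%N); last first.
  congr (_ * _); apply: eq_bigr => l _; rewrite /f lq_div.
  by congr (expi2pi _ * _); ring.
rewrite -(@average_character N f)// /= -mulr_sumr; congr (_ * (_ * _)).
under [RHS]eq_bigr do rewrite mulr_suml.
rewrite [RHS]exchange_big/=; apply: eq_bigr => j _; apply: eq_bigr => k _.
have -> : F (m%:R * ((a + j%:R) / m%:R), (m%:R * c + k%:R) / m%:R,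
      z + k%:R * ((a + j%:R) / m%:R)) =
    F (a + j%:R, c + k%:R / m%:R, z + k%:R * ((a + j%:R) / m%:R)).
  by congr (F (_, _, _)); field.
rewrite (twisted_nat1 tF) cF /f [RHS]mulrA -expi2piD.
by congr (expi2pi _ * _); ring.
Qed.

End pointwise.

(** * The operators on a central character space *)

Section main_parts.
Context (R : realType) (m : nat) (N : int).
Hypothesis m0 : (0 < m)%N.
Implicit Types (F G : R * R * R -> R[i]).

Let mR : m%:R != 0 :> R. Proof. by rewrite pnatr_eq0 -lt0n. Qed.
Let d := gcdn m `|N|%N.
Let d0 : (0 < d)%N. Proof. by rewrite gcdn_gt0 m0. Qed.
Let dR : d%:R != 0 :> R. Proof. by rewrite pnatr_eq0 -lt0n. Qed.

Lemma adjoint_hecke_ae F : inH F -> adjoint (@hecke R m) F =ae hecke_star m F.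
Proof. exact: adjoint_ae (is_adjoint_hecke R m0). Qed.

Lemma inH_adjoint_hecke F : inH F -> inH (adjoint (@hecke R m) F).
Proof. by apply: (is_adjoint_adjoint (is_adjoint_hecke R m0)).1. Qed.

Lemma adjoint_fourier_ae F : inH F ->
  adjoint (@fourier R) F =ae fourier (fourier (fourier F)).
Proof. exact: adjoint_ae (is_adjoint_fourier R). Qed.

Lemma adjoint_hecke_formula F : inHN N F ->
  inHN N (adjoint (@hecke R m) F) /\
  adjoint (@hecke R m) F =ae (fun g => let: (a, c, z) := g in
    m%:R^-1 * \sum_(k < m)
      expi2pi (k%:R * N%:~R * a) * F (m%:R * a, (c + k%:R) / m%:R, z)).
Proof.
move=> HF; have [F1 [iF1 FF1 cF1]] := inHN_central HF.
have iF := HF.1.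
have aF1 : adjoint (@hecke R m) F =ae hecke_star m F1.
  exact: (ae_eq_trans (adjoint_hecke_ae iF) (ae_hecke_star m0 FF1)).
split.
  have iS := inH_hecke_star m0 iF1; have cS := central_hecke_star m cF1.
  split; first exact: inH_adjoint_hecke.
  exists (hecke_star m F1); split=> //.
  by apply: aeW => -[[a c] z] _; rewrite -cS add0r.
apply: (ae_eq_trans aF1).
pose phi (k : 'I_m) := skew m%:R 0 m%:R^-1 (k%:R / m%:R) (fun _ : R * R => 0).
have nphi k : nonsingular (@haar R) (phi k).
  by apply: nonsingular_haar_skew => //; rewrite invr_eq0.
apply: haar_aeS (ae_comp nphi FF1) => -[[a c] z] H _.
rewrite (hecke_star_central m cF1); congr (_ * _); apply: eq_bigr => k _.
by have := H k; rewrite /phi /skew/= !addr0 (mulrC _ c) -mulrDl => ->.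
Qed.

Lemma adjoint_hecke_fourier F : inH F ->
  adjoint (@hecke R m) F =ae adjoint (@fourier R) (hecke m (fourier F)).
Proof.
move=> iF; apply: (ae_eq_trans (adjoint_hecke_ae iF)); rewrite -hecke_starE//.
apply/ae_eq_sym/adjoint_fourier_ae; apply: inH_hecke => //.
exact: inH_fourier.
Qed.

Lemma adjoint_hecke_hecke F : inHN N F ->
  adjoint (@hecke R m) (hecke m F) =ae (fun g => let: (a, c, z) := g in
    m%:R^-1 * \sum_(l < d) F (a + l%:R / d%:R, c, z)).
Proof.
move=> HF; have [F1 [iF1 FF1 cF1]] := inHN_central HF; have iF := HF.1.
have /inHP[_ tF1] := iF1.
apply: (ae_eq_trans (adjoint_hecke_ae (inH_hecke m0 iF))).
apply: (ae_eq_trans (ae_hecke_star m0 (ae_hecke m0 FF1))).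
pose phi (l : 'I_d) := skew 1 (l%:R / d%:R) 1 0 (fun _ : R * R => 0).
have nphi l : nonsingular (@haar R) (phi l).
  by apply: nonsingular_haar_skew => //; rewrite oner_neq0.
apply: haar_aeS (ae_comp nphi FF1) => -[[a c] z] H _.
rewrite (hecke_star_hecke m0 tF1 cF1); congr (_ * _); apply: eq_bigr => l _.
by have := H l; rewrite /phi /skew/= !mul1r !addr0 => ->.
Qed.

Lemma hecke_adjoint_hecke F : inHN N F ->
  hecke m (adjoint (@hecke R m) F) =ae (fun g => let: (a, c, z) := g in
    m%:R^-1 * \sum_(l < d)
      expi2pi (N%:~R * l%:R / d%:R * a) * F (a, c + l%:R / d%:R, z)).
Proof.
move=> HF; have [F1 [iF1 FF1 cF1]] := inHN_central HF; have iF := HF.1.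
have /inHP[_ tF1] := iF1.
apply: (ae_eq_trans (ae_hecke m0 (adjoint_hecke_ae iF))).
apply: (ae_eq_trans (ae_hecke m0 (ae_hecke_star m0 FF1))).
pose phi (l : 'I_d) := skew 1 0 1 (l%:R / d%:R) (fun _ : R * R => 0).
have nphi l : nonsingular (@haar R) (phi l).
  by apply: nonsingular_haar_skew => //; rewrite oner_neq0.
apply: haar_aeS (ae_comp nphi FF1) => -[[a c] z] H _.
rewrite (hecke_hecke_star m0 tF1 cF1); congr (_ * _); apply: eq_bigr => l _.
by have := H l; rewrite /phi /skew/= !mul1r !addr0 => ->.
Qed.

Lemma hecke_coprime F : d = 1%N -> inHN N F ->
  hecke m (adjoint (@hecke R m) F) =ae (fun g => m%:R^-1 * F g) /\
  adjoint (@hecke R m) (hecke m F) =ae (fun g => m%:R^-1 * F g).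
Proof.
move=> d1 HF; split.
  apply: (ae_eq_trans (hecke_adjoint_hecke HF)); rewrite d1.
  apply: aeW => -[[a c] z] _; rewrite big_ord1 mulr0 !mul0r expi2pi0 mul1r.
  by rewrite addr0.
apply: (ae_eq_trans (adjoint_hecke_hecke HF)); rewrite d1.
by apply: aeW => -[[a c] z] _; rewrite big_ord1 mul0r addr0.
Qed.

Lemma lebesgue_unit_itv : lebesgue_measure (`[0%R, 1%R]%classic : set R) = 1%E.
Proof. by rewrite lebesgue_measure_itv/= lte_fin ltr01 oppr0 adde0. Qed.

(** The witness of noncommutation: supported where the fractional part of [a]
    is less than [1/d]. *)
Definition strip : R * R * R -> R[i] :=
  quasi_extend N (fun x _ => if x < d%:R^-1 then 1 else 0).

Lemma strip_inHN : inHN N strip.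
Proof.
apply: central_inHN; last exact: central_quasi_extend.
apply/inHP; split; last exact: twisted_quasi_extend.
pose f (g : R * R * R) : R[i] := if g.1.1 < d%:R^-1 then 1 else 0.
have mlt : measurable_fun setT (fun g : R * R * R => g.1.1 < d%:R^-1).
  by apply: measurable_fun_ltr => //; exact: measurable_proj1.
have mf : cmeasurable f.
  split.
    rewrite (_ : (fun g => Re (f g)) = fun g => if g.1.1 < d%:R^-1 then 1 else 0).
      exact: measurable_fun_ifT.
    by apply/funext => g; rewrite /f; case: ifP.
  rewrite (_ : (fun g => Im (f g)) = cst 0); first exact: measurable_cst.
  by apply/funext => g; rewrite /f; case: ifP.
have ms : cmeasurable strip := cmeasurable_quasi_extend N mf.
split=> //.
have n1 g : nsq (strip g) <= 1.
  rewrite /strip /quasi_extend nsqM nsq_expi2pi mul1r; case: ifP => _; rewrite nsqE/=.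
    by rewrite expr1n expr0n addr0.
  by rewrite expr0n addr0.
apply: (@le_lt_trans _ _ (\int[@haar R]_(g in @unit_cube R) 1%:E)%E).
  apply: ge0_le_integral => //.
  - exact: measurable_unit_cube.
  - by move=> g _; rewrite lee_fin nsq_ge0.
  - exact: measurable_funTS (measurable_nsqE ms).
  - by move=> g _; rewrite lee_fin.
rewrite integral_unit_cube//.
rewrite /cube_int.
have c1 : circle_int (cst 1%:E) = 1%:E :> \bar R.
  by rewrite /circle_int integral_cst// mul1e; exact: lebesgue_unit_itv.
by rewrite !c1 ltry.
Qed.

(** Half-open in [a], so that the translate by [(d - 1)/d] lies in
    [[1, 1 + 1/d[], inside the support of [strip]. *)
Definition box : set (R * R * R) :=
  `[d%:R^-1, 2 / d%:R[%classic `*` `[0, 1]%classic `*` `[0, 1]%classic.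

Lemma measurable_box : measurable (box :
  set (measurableTypeR R * measurableTypeR R * measurableTypeR R)).
Proof. by apply: measurableX => //; exact: measurableX. Qed.

Lemma haar_box : @haar R box = (d%:R^-1)%:E.
Proof.
pose I : set R := `[d%:R^-1, 2 / d%:R[%classic; pose J : set R := `[0, 1]%classic.
have mI : measurable (I : set (measurableTypeR R)) by exact: measurable_itv.
have mJ : measurable (J : set (measurableTypeR R)) by exact: measurable_itv.
have -> : @haar R box = (plane (I `*` J) * lebesgue_measure J)%E.
  exact: (@product_measure1E _ _ _ _ R (@plane R) (@lebesgue_measure R) _ _
    (measurableX mI mJ) mJ).
have -> : plane (I `*` J) = (lebesgue_measure I * lebesgue_measure J)%E.
  exact: (@product_measure1E _ _ _ _ R (@lebesgue_measure R) (@lebesgue_measure R)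
    _ _ mI mJ).
rewrite lebesgue_unit_itv !mule1 lebesgue_measure_itv/= lte_fin ltr_pdivlMr ?ltr0n//.
by rewrite mulVf// ltr1n/= -EFinD; congr EFin; field.
Qed.

Lemma floor_frac (n : int) (a : R) : 0 <= a - n%:~R < 1 -> Num.floor a = n.
Proof.
by move=> /andP[a0 a1]; apply: floor_def; rewrite -subr_ge0 a0 intrD1 -ltrBlDl.
Qed.

Lemma strip_in (n : int) a c z :
  0 <= a - n%:~R < d%:R^-1 -> nsq (strip (a, c, z)) = 1.
Proof.
move=> /andP[a0 a1]; rewrite /strip /quasi_extend nsqM nsq_expi2pi mul1r /fold_a/=.
rewrite (@floor_frac n) ?a1 ?nsqE/= ?expr1n ?expr0n ?addr0// a0.
by rewrite (lt_le_trans a1)// invf_le1 ?ler1n ?ltr0n.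
Qed.

Lemma strip_out (n : int) a c z :
  d%:R^-1 <= a - n%:~R < 1 -> strip (a, c, z) = 0.
Proof.
move=> /andP[a0 a1]; rewrite /strip /quasi_extend /fold_a/=.
have -> : Num.floor a = n.
  by apply: floor_frac; rewrite a1 andbT (le_trans _ a0)// invr_ge0.
by rewrite ltNge a0 mulr0.
Qed.

(** On [box] the composite [T_m T_m^*] gives zero, as it only translates [c],
    while [T_m^* T_m] has the single nonzero term [l = d - 1]. *)
Lemma hecke_not_commute : (1 < d)%N ->
  ~ commute_on (inHN N) (@hecke R m) (adjoint (@hecke R m)).
Proof.
move=> d1 com; have HS := strip_inHN.
have E := ae_eq_trans (ae_eq_sym (hecke_adjoint_hecke HS))
  (ae_eq_trans (com _ HS) (adjoint_hecke_hecke HS)).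
have : {ae @haar R, forall g, ~ box g}.
  apply: haar_aeS E => -[[a c] z] /(_ I) + [[/= + _] _].
  rewrite in_itv/= => + /andP[a1 a2].
  have dR' : 0 < d%:R :> R by rewrite ltr0n.
  have d2 : 2 / d%:R <= 1 :> R by rewrite ler_pdivrMr// mul1r ler_nat.
  rewrite big1 => [|l _]; last first.
    by rewrite (@strip_out 0) ?mulr0// mulr0z subr0 a1 (lt_le_trans a2).
  have ld : (d.-1 < d)%N by rewrite prednK.
  have dP : d.-1%:R = d%:R - 1 :> R by rewrite -subn1 natrB.
  rewrite (bigD1 (Ordinal ld))//= big1 => [|l lmax]; last first.
    have l2 : (l.+2 <= d)%N.
      by move: lmax (ltn_ord l); rewrite -val_eqE/=; lia.
    apply: (@strip_out 0); rewrite mulr0z subr0 (le_trans a1) ?lerDl ?divr_ge0//=.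
    have l2R : (l%:R + 2) / d%:R <= 1 :> R.
      by rewrite ler_pdivrMr// mul1r -natrD ler_nat addn2.
    by apply: lt_le_trans l2R; rewrite mulrDl addrC ltrD2l.
  rewrite addr0 mulr0 => /esym/eqP; rewrite mulf_eq0 invr_eq0 pnatr_eq0.
  rewrite gtn_eqF//= => /eqP s0.
  have := @strip_in 1 (a + d.-1%:R / d%:R) c z; rewrite s0 /= dP.
  have -> : a + (d%:R - 1) / d%:R - 1%:~R = a - d%:R^-1 by field.
  rewrite subr_ge0 a1 ltrBlDl.
  have -> : d%:R^-1 + d%:R^-1 = 2 / d%:R :> R by field.
  rewrite a2 => /(_ isT)/eqP.
  by rewrite nsqE/= expr0n addr0 eq_sym oner_eq0.
move=> [B [mB B0 sB]].
have : (@haar R box <= @haar R B)%E.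
  apply: le_measure; rewrite ?inE//; first exact: measurable_box.
  by move=> g bg; apply: sB => /=; apply.
rewrite haar_box B0 lee_fin leNgt invr_gt0 ltr0n.
by rewrite d0.
Qed.

End main_parts.

Theorem theorem4p3 (R : realType) (m : nat) (N : int) (hm : (0 < m)%N) :
  let T := @hecke R m in
  let Tstar := adjoint T in
  let Four := @fourier R in
  let Fourstar := adjoint Four in
  let d := gcdn m `|N|%N in
  (* (i) *)
  (forall F, inHN N F ->
     inHN N (Tstar F) /\
     Tstar F =ae (fun g => let: (a, c, z) := g in
       m%:R^-1 * \sum_(k < m)
         expi2pi (k%:R * N%:~R * a) * F (m%:R * a, (c + k%:R) / m%:R, z)))
  /\
  (* (ii) *)
  ((forall F, inH F -> Fourstar F =ae Four (Four (Four F))) /\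
   (forall F, inHN N F -> Tstar F =ae Fourstar (T (Four F))))
  /\
  (* (iii) *)
  [/\ forall F, inHN N F ->
        Tstar (T F) =ae (fun g => let: (a, c, z) := g in
          m%:R^-1 * \sum_(l < d) F (a + l%:R / d%:R, c, z)),
      forall F, inHN N F ->
        T (Tstar F) =ae (fun g => let: (a, c, z) := g in
          m%:R^-1 * \sum_(l < d)
            expi2pi (N%:~R * l%:R / d%:R * a) * F (a, c + l%:R / d%:R, z)),
      d = 1%N ->
        commute_on (inHN N) T Tstar /\
        (forall F, inHN N F ->
           T (Tstar F) =ae (fun g => m%:R^-1 * F g) /\
           Tstar (T F) =ae (fun g => m%:R^-1 * F g))
    & (1 < d)%N -> ~ commute_on (inHN N) T Tstar].
Proof.
move=> T Tstar Four Fourstar d; split; last split.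
- exact: adjoint_hecke_formula.
- split; first exact: adjoint_fourier_ae.
  by move=> F [iF _]; exact: adjoint_hecke_fourier.
- split.
  + exact: adjoint_hecke_hecke.
  + exact: hecke_adjoint_hecke.
  + move=> d1; split=> F HF; last exact: (hecke_coprime hm d1 HF).
    have [H1 H2] := hecke_coprime hm d1 HF.
    exact: (ae_eq_trans H1 (ae_eq_sym H2)).
  + exact: hecke_not_commute.
Qed.
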